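(* Let $\phi>1$, $\alpha>\tfrac{1}{2+2\phi}$, let $G=(V,E)$ be a $(\phi,\alpha)$-expander on $n$ nodes, and let $k>\log^3 n$. Then with high probability rumor spreading on $G$ with the $k$-PUSH&PULL protocol requires the following number of rounds: \[ O\left(\left(\log_{\phi} n+\phi^{-1}\left(\alpha-\tfrac{1}{2+2\phi}\right)^{-1}\right)\log_{k} n\right). \]
   Context: Graphs are finite, simple, undirected and unweighted. For $S\subseteq V$ let $N(S)=\{v\in V:\exists s\in S,\ \{s,v\}\in E\}$ and $\partial S=N(S)\setminus S$. For $\phi\in(0,n)$ and $\alpha\in(0,\tfrac12]$, a graph $G=(V,E)$ with $n$ nodes is a $(\phi,\alpha)$-expander (small-set vertex expander) if $|\partial S|\ge \phi|S|$ for every $S\subseteq V$ with $0<|S|\le\alpha n$. The $k$-PUSH&PULL protocol: initially one arbitrary node knows a rumor (is informed). The process proceeds in synchronous rounds. In each round every node independently samples $k$ of its neighbors uniformly at random with replacement; every informed node sends the rumor to all the neighbors it sampled (push), and, simultaneously, every uninformed node requests the rumor from all the neighbors it sampled and becomes informed if at least one of them was informed at the start of the round (pull). Informed nodes stay informed. Rumor spreading is completed when all nodes are informed; the number of rounds required is the first round after which this holds. A statement holds with high probability (w.h.p.) if it holds with probability at least $1-n^{-c}$, where $c>0$ is a constant hidden in the asymptotic notation (i.e. for every constant $c>0$ the statement holds with probability at least $1-n^{-c}$ for a suitable implied constant depending only on $c$).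
   Formalization: As stated it fails when rounding αn empties the expander condition (φ=n−1, α=1/(n+1), disconnected G) or for k→∞ with n fixed; proved assuming αn−⌊αn⌋ ≤ (αn−n/(2+2φ))/2, and with max(1, log_k n) for log_k n (equal when k≤n). *)

(* Defs.v *)
From HB Require Import structures.
From mathcomp Require Import all_boot all_order all_algebra.
From mathcomp Require Import reals exp.

Set Implicit Arguments.
Unset Strict Implicit.
Unset Printing Implicit Defensive.

Import Order.TTheory GRing.Theory Num.Theory.
Local Open Scope ring_scope.

Section Graph.
Variables (V : finType) (E : rel V).

Definition nbhd (S : {set V}) : {set V} := [set v | [exists s in S, E s v]].

Definition boundary (S : {set V}) : {set V} := nbhd S :\: S.

Definition expander (R : realType) (phi alpha : R) : Prop :=
  [/\ 0 < phi < #|V|%:R,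
      0 < alpha <= 2^-1
    & forall S : {set V}, (0 < #|S|)%N -> #|S|%:R <= alpha * #|V|%:R ->
        phi * #|S|%:R <= #|boundary S|%:R].

(* The expander condition depends on alpha only through the integer part of
   alpha * n.  This says that the rounding loss alpha * n - floor (alpha * n)
   is at most half of the excess alpha * n - n / (2 + 2 phi).  It holds when
   alpha * n is an integer, and also when the excess is at least 2.  Without
   it an expander with alpha > 1 / (2 + 2 phi) may be disconnected: for
   instance any graph, if alpha * n < 1. *)
Definition small_rounding (R : realType) (phi alpha : R) : Prop :=
  alpha * #|V|%:R - (Num.truncn (alpha * #|V|%:R))%:R
    <= (alpha * #|V|%:R - #|V|%:R / (2 + 2 * phi)) / 2.

End Graph.

Section PushPull.
Variables (V : finType) (E : rel V) (k : nat).

(* The random choices of one round: [w v i] is the i-th sample of v. *)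
Definition choices : finType := {ffun V -> {ffun 'I_k -> V}}.

Definition push_pull (I : {set V}) (w : choices) : {set V} :=
  I :|: [set v | [exists u in I, exists i, w u i == v]]
    :|: [set v | [exists i, w v i \in I]].

Definition informed (s : V) (ws : seq choices) : {set V} :=
  foldl push_pull [set s] ws.

(* The first j such that all nodes are informed after the first j rounds of
   ws; it is (size ws).+1 if some node is still uninformed at the end. *)
Definition rounds_required (s : V) (ws : seq choices) : nat :=
  find (fun j => informed s (take j ws) == [set: V]) (iota 0 (size ws).+1).

(* An isolated node samples itself, which has no effect, so that the law below
   is a probability for every graph. *)
Definition sample_space (v : V) : {set V} :=
  if nbhd E [set v] == set0 then [set v] else nbhd E [set v].

Variable R : realType.

(* Samples of all nodes are independent and uniform. *)
Definition choices_pr (w : choices) : R :=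
  \prod_(v : V) \prod_(i < k)
    (if w v i \in sample_space v then (#|sample_space v|%:R)^-1 else 0).

(* Probability of an event depending on the first t rounds, which are
   independent. *)
Definition Pr (t : nat) (A : pred (t.-tuple choices)) : R :=
  \sum_(ws : t.-tuple choices | A ws) \prod_(j < t) choices_pr (tnth ws j).

End PushPull.

Definition logb (R : realType) (b x : R) : R := ln x / ln b.

(* For k <= n the factor [max 1 (log_k n)] is log_k n.  For fixed n, log_k n
   tends to 0 as k grows, whereas the number of rounds is at least the
   eccentricity of the source, whence the maximum. *)
Definition rounds_bound (R : realType) (n k : nat) (phi alpha : R) : R :=
  (logb phi n%:R + phi^-1 * (alpha - (2 + 2 * phi)^-1)^-1)
    * Num.max 1 (logb k%:R n%:R).

(* Main.v *)
(** Let [L] be a large multiple of [ln n] and let [S] be the informed set, with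
    boundary of size [b].  Follow the simple random walk started uniformly on
    the boundary.  As long as the expected number of informed neighbours of the
    nodes reached at step [j] is at least [L], it is concentrated, so the walk
    describes the spread of the rumor, whose volume is multiplied by [k / O(L)]
    in each round through pulls alone.  The walk is stopped where it becomes
    thin (fewer than [L] expected informed neighbours) or full (so many informed
    neighbours that the node is informed with high probability).  Since the
    volume is at most [n ^ 2], it is stopped within [J = O(log_k n)] steps.  If
    it mostly stops at full nodes, then, since an uninformed node has at most a
    fraction [L / k] of its neighbours informed one round before, following the
    walk backwards shows that a constant fraction of the boundary is informed
    after [2 J] rounds.  If it often stops at thin nodes at step [j], then these
    are many distinct nodes, and the boundary is multiplied by
    [(k / O(L ^ 2)) ^ j >= k ^ (j / 4)] after [j] rounds, which can be charged
    to the growth of the boundary.  Boundary nodes of very high degree are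
    dealt with separately: informing a single one of them enlarges the boundary
    sufficiently.

    A potential argument turns this into two regimes: while [S] has at most
    [alpha n] nodes it grows by a factor [1 + phi / 16] every [O(log_k n)]
    rounds, and from then on until it has more than half of the nodes its
    boundary has [Omega (phi (alpha - 1 / (2 + 2 phi)) n)] nodes.  Finally a
    round is a symmetric relation between nodes, so running the second half of
    the rounds backwards from a node [v] gives another set with more than half
    of the nodes, which meets the first one: [v] is informed.

    When [k] is bounded in terms of the exponent [c], so is [n], and a crude
    bound suffices. *)
Require Import Defs.
From HB Require Import structures.
From mathcomp Require Import all_boot all_order all_algebra.
From mathcomp Require Import reals sequences exp.
From mathcomp Require Import zify ring lra.

Set Implicit Arguments.
Unset Strict Implicit.
Unset Printing Implicit Defensive.

Import Order.TTheory GRing.Theory Num.Theory.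
Local Open Scope ring_scope.

(** * Elementary bounds for the exponential *)

Section ExpBounds.
Variable R : realType.
Implicit Types x q : R.

Lemma expRN_le_half x : 0 <= x <= 1 -> expR (- x) <= 1 - x / 2.
Proof.
move=> /andP[x0 x1]; have hx := expR_ge1Dx x; have h := expRxMexpNx_1 x.
have hN := expR_ge0 (- x); nra.
Qed.

Lemma expR_half_le2 : expR 2^-1 <= 2 :> R.
Proof.
have := expR_ge1Dx (- 2^-1 : R); have := expRxMexpNx_1 (2^-1 : R).
have := expR_ge0 (2^-1 : R); nra.
Qed.

Lemma onem_exp_le q k : q <= 1 -> (1 - q) ^+ k <= expR (- (k%:R * q)).
Proof.
move=> q1; rewrite -mulrN expRM_natl lerXn2r ?nnegrE ?expR_ge0 ?subr_ge0 //.
exact: expR_ge1Dx.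
Qed.

Lemma onem_exp_ge q k : 0 <= q <= 1 -> 1 - k%:R * q <= (1 - q) ^+ k.
Proof.
move=> /andP[q0 q1]; elim: k => [|k IH]; first by rewrite expr0; lra.
have h : 0 <= (1 - q) ^+ k <= 1 by rewrite exprn_ge0 ?exprn_ile1 //; lra.
rewrite exprS mulrBl mul1r -natr1; have := ler_wpM2l q0 (proj2 (andP h)); lra.
Qed.

End ExpBounds.

(** * The samples of one round *)

Section OneRound.
Variables (R : realType) (V : finType) (E : rel V) (k : nat).
Local Notation choices := (choices V k).
Local Notation sp := (sample_space E).

Definition sample_pr (v u : V) : R :=
  if u \in sp v then (#|sp v|%:R)^-1 else 0.

Definition expect (f : choices -> R) : R := \sum_w choices_pr E R w * f w.

Definition prob (A : pred choices) : R := expect (fun w => (A w)%:R).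

Definition node_expect v (f : {ffun 'I_k -> V} -> R) : R :=
  \sum_(g : {ffun 'I_k -> V}) (\prod_(i < k) sample_pr v (g i)) * f g.

Definition node_prob v (A : pred {ffun 'I_k -> V}) : R :=
  node_expect v (fun g => (A g)%:R).

Lemma sample_pr_ge0 v u : 0 <= sample_pr v u.
Proof. by rewrite /sample_pr; case: ifP => // _; rewrite invr_ge0 ler0n. Qed.

Lemma card_sample_space_gt0 v : (0 < #|sp v|)%N.
Proof.
rewrite /sample_space; case: ifPn; first by rewrite cards1.
by rewrite -card_gt0.
Qed.

Lemma sum_sample_pr v (X : {set V}) :
  \sum_u sample_pr v u * (u \in X)%:R = #|X :&: sp v|%:R / #|sp v|%:R.
Proof.
rewrite (eq_bigr (fun u => (u \in X :&: sp v)%:R / #|sp v|%:R)); last first.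
  by move=> u _; rewrite /sample_pr inE; do 2 case: (_ \in _); rewrite /= ?(mul0r, mulr0, mul1r, mulr1).
rewrite -mulr_suml; congr (_ / _); rewrite -sum1_card natr_sum [RHS]big_mkcond.
by apply: eq_bigr => u _; case: (_ \in _).
Qed.

Lemma sum_sample_pr1 v : \sum_u sample_pr v u = 1.
Proof.
have := sum_sample_pr v setT; rewrite setTI divff ?pnatr_eq0 -?lt0n ?card_sample_space_gt0 //.
by under eq_bigr do rewrite inE mulr1.
Qed.

(** Independence of the samples of one node: the product of sums expands into a sum over all
    functions [g]. *)
Lemma node_expect_prod v (h : 'I_k -> V -> R) :
  node_expect v (fun g => \prod_i h i (g i)) = \prod_i \sum_u sample_pr v u * h i u.
Proof.
by rewrite /node_expect bigA_distr_bigA; apply: eq_bigr => g _; rewrite big_split.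
Qed.

(** Independence of the nodes, by the same expansion one level up. *)
Lemma expect_prod (f : V -> {ffun 'I_k -> V} -> R) :
  expect (fun w => \prod_v f v (w v)) = \prod_v node_expect v (f v).
Proof.
by rewrite /expect bigA_distr_bigA; apply: eq_bigr => w _; rewrite -big_split.
Qed.

Lemma node_expect_cst v c : node_expect v (fun=> c) = c.
Proof.
have := node_expect_prod v (fun _ _ => 1); rewrite [RHS]big1 => [h|i _]; last first.
  by under eq_bigr do rewrite mulr1; exact: sum_sample_pr1.
rewrite /node_expect -mulr_suml -[RHS]mul1r -[X in _ = X * c]h; congr (_ * _).
by apply: eq_bigr => g _; rewrite [X in _ * X]big1 // mulr1.
Qed.

Lemma expect_cst c : expect (fun=> c) = c.
Proof.
have := expect_prod (fun _ _ => 1); rewrite [RHS]big1 => [h|v _]; last exact: node_expect_cst.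
rewrite /expect -mulr_suml -[RHS]mul1r -[X in _ = X * c]h; congr (_ * _).
by apply: eq_bigr => g _; rewrite [X in _ * X]big1 // mulr1.
Qed.

Lemma choices_pr_ge0 (w : choices) : 0 <= choices_pr E R w :> R.
Proof.
by apply: prodr_ge0 => v _; apply: prodr_ge0 => i _; exact: sample_pr_ge0.
Qed.

Lemma le_expect f g : (forall w, f w <= g w) -> expect f <= expect g.
Proof. by move=> fg; apply: ler_sum => w _; rewrite ler_wpM2l ?choices_pr_ge0. Qed.

Lemma expectD f g : expect (fun w => f w + g w) = expect f + expect g.
Proof. by rewrite -big_split; apply: eq_bigr => w _; rewrite mulrDr. Qed.

Lemma expectZ c f : expect (fun w => c * f w) = c * expect f.
Proof. by rewrite mulr_sumr; apply: eq_bigr => w _; rewrite mulrCA. Qed.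

Lemma expect_sum (I : finType) (P : pred I) (f : I -> choices -> R) :
  expect (fun w => \sum_(i | P i) f i w) = \sum_(i | P i) expect (f i).
Proof.
by rewrite /expect exchange_big /=; apply: eq_bigr => w _; rewrite mulr_sumr.
Qed.

Lemma le_prob (A B : pred choices) : (forall w, A w -> B w) -> prob A <= prob B.
Proof.
move=> AB; apply: le_expect => w; rewrite ler_nat.
by case: (A w) (AB w) => [->|].
Qed.

Lemma prob_pred0 (A : pred choices) : (forall w, ~~ A w) -> prob A = 0.
Proof.
by move=> A0; rewrite -(expect_cst 0); apply: eq_bigr => w _; rewrite (negbTE (A0 w)).
Qed.

Lemma prob_or (A B : pred choices) : prob (fun w => A w || B w) <= prob A + prob B.
Proof.
by rewrite -expectD; apply: le_expect => w; case: (A w) (B w) => -[]; rewrite -natrD ler_nat.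
Qed.

Lemma prob_exists (I : finType) (P : pred I) (A : I -> pred choices) :
  prob (fun w => [exists i, P i && A i w]) <= \sum_(i | P i) prob (A i).
Proof.
rewrite -expect_sum; apply: le_expect => w; case: existsP => [[i /andP[Pi Ai]]|_].
  by rewrite (bigD1 i) //= Ai lerDl sumr_ge0.
by rewrite sumr_ge0.
Qed.

Lemma le_node_expect v f g : (forall w, f w <= g w) -> node_expect v f <= node_expect v g.
Proof.
by move=> fg; apply: ler_sum => w _; rewrite ler_wpM2l // prodr_ge0 // => i _; exact: sample_pr_ge0.
Qed.

Lemma node_prob_ge0 v A : 0 <= node_prob v A.
Proof. by rewrite -(node_expect_cst v 0); apply: le_node_expect. Qed.

(** Moment generating function of a Bernoulli variable, the input of both Chernoff bounds. *)
Lemma node_expect_exp v (A : pred {ffun 'I_k -> V}) (x : R) :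
  node_expect v (fun g => expR (x * (A g)%:R)) = 1 + (expR x - 1) * node_prob v A.
Proof.
rewrite -[X in _ = X + _](node_expect_cst v) /node_prob /node_expect mulr_sumr -big_split /=.
by apply: eq_bigr => g _; case: (A g); rewrite ?mulr0 ?mulr1 ?expR0; ring.
Qed.

Lemma markov_exp (A : pred choices) (f : choices -> R) (b : R) :
  (forall w, A w -> b <= f w) ->
  prob A <= expR (- b) * expect (fun w => expR (f w)).
Proof.
move=> Af; rewrite -expectZ; apply: le_expect => w.
case: (A w) (Af w) => [/(_ isT) h|_]; last by rewrite mulr_ge0 ?expR_ge0.
by rewrite -expRD; rewrite -[leLHS]expR0 ler_expR; lra.
Qed.

(** Exponential moment with parameter [- 1 / M]. By [expRN_le_half] each node contributes a factor
    at most [expR (- (c v * p v / (2 * M)))], which beats the Markov factor [expR (mu / (4 * M))].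
    The estimate [p] is needed only where the weight is positive. *)
Lemma chernoff_lower (a : V -> pred {ffun 'I_k -> V}) (c p : V -> R) (M : R) :
  0 < M -> (forall v, 0 <= c v <= M) -> (forall v, 0 < c v -> p v <= node_prob v (a v)) ->
  prob (fun w => \sum_v c v * (a v (w v))%:R < (\sum_v c v * p v) / 4)
    <= expR (- ((\sum_v c v * p v) / (4 * M))).
Proof.
move=> M0 cM pa; set mu := \sum_v c v * p v.
have step : forall w, \sum_v c v * (a v (w v))%:R < mu / 4 ->
    - (mu / (4 * M)) <= \sum_v - (c v / M) * (a v (w v))%:R.
  move=> w /ltW h; rewrite (eq_bigr (fun v => - M^-1 * (c v * (a v (w v))%:R))).
    have -> : mu / (4 * M) = M^-1 * (mu / 4) by field; rewrite gt_eqF.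
    by rewrite -mulr_sumr mulNr lerN2 ler_wpM2l // invr_ge0 ltW.
  by move=> v _; ring.
apply: (le_trans (markov_exp step)); rewrite opprK.
have -> : expect (fun w => expR (\sum_v - (c v / M) * (a v (w v))%:R))
    = \prod_v (1 + (expR (- (c v / M)) - 1) * node_prob v (a v)).
  rewrite -(eq_bigr _ (fun v _ => node_expect_exp v (a v) (- (c v / M)))) -expect_prod.
  by apply: eq_bigr => w _; rewrite expR_sum.
have : \prod_v (1 + (expR (- (c v / M)) - 1) * node_prob v (a v))
    <= \prod_v expR (- (c v * p v / (2 * M))).
  apply: ler_prod => v _; rewrite -node_expect_exp; apply/andP; split.
    by rewrite -(node_expect_cst v 0); apply: le_node_expect => g; exact: expR_ge0.
  rewrite node_expect_exp.
  have /andP[c0 cM'] := cM v; have := node_prob_ge0 v (a v).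
  have [c00|cne] := eqVneq (c v) 0.
    by rewrite c00 !mul0r !oppr0 expR0 subrr mul0r addr0.
  have cp : 0 < c v by rewrite lt_def cne c0.
  have h1 : 0 <= c v / M <= 1 by rewrite divr_ge0 ?(ltW M0) //= ler_pdivrMr // mul1r.
  move=> np0; apply: (@le_trans _ _ (1 - c v / M / 2 * node_prob v (a v))).
    by have := expRN_le_half h1; nra.
  apply: (@le_trans _ _ (1 - c v / M / 2 * p v)).
    rewrite lerD2l lerN2 ler_wpM2l ?pa // divr_ge0 //; by case/andP: h1.
  have -> : c v * p v / (2 * M) = c v / M / 2 * p v by field; rewrite gt_eqF.
  exact: expR_ge1Dx.
rewrite -expR_sum => h; apply: (le_trans (ler_wpM2l (expR_ge0 _) h)).
rewrite -expRD ler_expR sumrN -mulr_suml -/mu.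
have -> : mu / (2 * M) = 2 * (mu / (4 * M)) by field; rewrite gt_eqF.
lra.
Qed.

(** Exponential moment with parameter 1/2: since [expR 2^-1 - 1 <= 1], it is at most [expR U], and
    the Markov factor is [expR (- (2 * U))]. *)
Lemma chernoff_upper (a : V -> pred {ffun 'I_k -> V}) (U : R) :
  \sum_v node_prob v (a v) <= U ->
  prob (fun w => 4 * U <= \sum_v (a v (w v))%:R) <= expR (- U).
Proof.
move=> hU.
have step : forall w, 4 * U <= \sum_v (a v (w v))%:R ->
    2 * U <= \sum_v 2^-1 * (a v (w v))%:R :> R.
  by move=> w h; rewrite -mulr_sumr; lra.
apply: (le_trans (markov_exp step)).
have -> : expect (fun w => expR (\sum_v 2^-1 * (a v (w v))%:R))
    = \prod_v (1 + (expR 2^-1 - 1) * node_prob v (a v)).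
  rewrite -(eq_bigr _ (fun v _ => node_expect_exp v (a v) 2^-1)) -expect_prod.
  by apply: eq_bigr => w _; rewrite expR_sum.
have : \prod_v (1 + (expR 2^-1 - 1) * node_prob v (a v)) <= \prod_v expR (node_prob v (a v)).
  apply: ler_prod => v _; rewrite -node_expect_exp; apply/andP; split.
    by rewrite -(node_expect_cst v 0); apply: le_node_expect => g; exact: expR_ge0.
  rewrite node_expect_exp; apply: le_trans (expR_ge1Dx _).
  have := node_prob_ge0 v (a v); have := @expR_half_le2 R; nra.
rewrite -expR_sum => h; apply: (le_trans (ler_wpM2l (expR_ge0 _) h)).
by rewrite -expRD ler_expR; lra.
Qed.

(* Both directions of a round are instances of this bound: [X v] is either the
   target of the pushes of [v], or the informed set from which [v] pulls. *)
Lemma prob_avoid (X : V -> {set V}) :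
  prob (fun w => [forall v, forall i, w v i \notin X v])
    <= expR (- (k%:R * \sum_v #|X v :&: sp v|%:R / #|sp v|%:R)).
Proof.
have -> : prob (fun w => [forall v, forall i, w v i \notin X v])
    = \prod_v (1 - #|X v :&: sp v|%:R / #|sp v|%:R) ^+ k.
  rewrite (eq_bigr (fun v => node_expect v (fun g => \prod_i (g i \in ~: X v)%:R))).
    rewrite -expect_prod; apply: eq_bigr => w _; congr (_ * _).
    have [/forallP h|] := boolP [forall v, forall i, w v i \notin X v].
      rewrite big1 // => v _; rewrite big1 // => i _.
      by rewrite inE; have /forallP/(_ i) -> := h v.
    rewrite negb_forall => /existsP[v]; rewrite negb_forall => /existsP[i /negPn hi].
    by rewrite (bigD1 v) //= (bigD1 i) //= inE hi !mul0r.
  move=> v _; rewrite (node_expect_prod v (fun _ u => (u \in ~: X v)%:R)) (eq_bigr (fun=> 1 - #|X v :&: sp v|%:R / #|sp v|%:R)).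
    by rewrite prodr_const card_ord.
  move=> i _; rewrite -sum_sample_pr -[X in _ = X - _](sum_sample_pr1 v) -sumrB; apply: eq_bigr => u _.
  by rewrite inE; case: (_ \in _); rewrite /=; ring.
rewrite mulr_sumr -sumrN expR_sum; apply: ler_prod => v _.
have h1 : #|X v :&: sp v|%:R / #|sp v|%:R <= 1 :> R.
  rewrite ler_pdivrMr ?ltr0n ?card_sample_space_gt0 // mul1r ler_nat.
  exact: subset_leq_card (subsetIr _ _).
by rewrite exprn_ge0 ?subr_ge0 // onem_exp_le.
Qed.

(** Complementary event: each of the first [m] samples misses [X], independently; the other samples
    are ignored. *)
Lemma node_prob_pull v (X : {set V}) (m : nat) : (m <= k)%N -> X \subset sp v ->
  node_prob v (fun g => [exists i : 'I_k, (i < m)%N && (g i \in X)])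
    = 1 - (1 - #|X|%:R / #|sp v|%:R) ^+ m.
Proof.
move=> mk Xsp; have -> : (1 - #|X|%:R / #|sp v|%:R) ^+ m
    = node_expect v (fun g => \prod_(i < k) (if (i < m)%N then (g i \in ~: X)%:R else 1)).
  rewrite (node_expect_prod v (fun (i : 'I_k) u => if (i < m)%N then (u \in ~: X)%:R else 1)).
  rewrite (eq_bigr (fun i : 'I_k => if (i < m)%N then 1 - #|X|%:R / #|sp v|%:R else 1)).
    rewrite -big_mkcond /= prodr_const; congr (_ ^+ _).
    by rewrite -sum1_card -(big_ord_widen k (fun=> 1%N) mk) sum1_card card_ord.
  move=> i _; case: ifP => _; last by under eq_bigr do rewrite mulr1; exact: sum_sample_pr1.
  have -> : #|X| = #|X :&: sp v| by rewrite (setIidPl Xsp).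
  rewrite -sum_sample_pr -[X in _ = X - _](sum_sample_pr1 v) -sumrB; apply: eq_bigr => u _.
  by rewrite inE; case: (_ \in _); rewrite /=; ring.
rewrite -[X in _ = X - _](node_expect_cst v) -sumrB; apply: eq_bigr => g _; rewrite -mulrBr; congr (_ * _).
have [/existsP[i /andP[im gi]]|] := boolP [exists i : 'I_k, (i < m)%N && (g i \in X)].
  by rewrite (bigD1 i) //= im inE gi /= mul0r subr0.
rewrite negb_exists => /forallP h; rewrite big1 ?subrr // => i _.
by case: ifP (h i) => //= _; rewrite inE => ->.
Qed.

(** As long as the expected number of hits is at most 1, the union bound is sharp up to a factor
    2. *)
Lemma node_prob_pull_bounds v (X : {set V}) (m : nat) : (m <= k)%N -> X \subset sp v ->
  (m * #|X| <= #|sp v|)%N ->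
  m%:R * #|X|%:R / (2 * #|sp v|%:R)
    <= node_prob v (fun g => [exists i : 'I_k, (i < m)%N && (g i \in X)])
    <= m%:R * #|X|%:R / #|sp v|%:R.
Proof.
move=> mk Xsp hm; rewrite node_prob_pull //.
have s0 : 0 < #|sp v|%:R :> R by rewrite ltr0n card_sample_space_gt0.
set q : R := #|X|%:R / #|sp v|%:R.
have q0 : 0 <= q <= 1.
  by apply/andP; split; [exact: divr_ge0|rewrite ler_pdivrMr // mul1r ler_nat subset_leq_card].
have mq : 0 <= m%:R * q <= 1.
  apply/andP; split; first by apply: mulr_ge0; rewrite ?ler0n //; case/andP: q0.
  by rewrite mulrA ler_pdivrMr // mul1r -natrM ler_nat.
apply/andP; split.
  have /andP[_ q1] := q0; have := onem_exp_le m q1; have := expRN_le_half mq.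
  by have -> : m%:R * #|X|%:R / (2 * #|sp v|%:R) = m%:R * q / 2 :> R; [rewrite /q; field; rewrite gt_eqF | lra].
by have := onem_exp_ge m q0; rewrite -mulrA -/q; lra.
Qed.

End OneRound.

(** * Several rounds *)

Section Rounds.
Variables (R : realType) (V : finType) (E : rel V) (k : nat).
Local Notation choices := (choices V k).
Local Notation expect := (@expect R V E k).
Local Notation prob := (@prob R V E k).

(** The first round is the outermost expectation, so that later rounds can be conditioned on the
    state reached; [expects_tuple] identifies this with the product law used by [Pr]. *)
Fixpoint expects (t : nat) (f : seq choices -> R) : R :=
  if t is t'.+1 then expect (fun w => expects t' (fun ws => f (w :: ws))) else f [::].

Definition prob_after (t : nat) (S : {set V}) (Q : pred {set V}) : R :=
  expects t (fun ws => (Q (foldl (@push_pull V k) S ws))%:R).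

Lemma sub_push_pull (S : {set V}) (w : choices) : S \subset push_pull S w.
Proof. by rewrite /push_pull -setUA subsetUl. Qed.

Lemma push_pullP (S : {set V}) (w : choices) (v : V) :
  reflect [\/ v \in S, exists2 u, u \in S & exists i, w u i = v | exists i, w v i \in S]
          (v \in push_pull S w).
Proof.
rewrite /push_pull !inE; apply: (iffP idP) => [/orP[/orP[]|]|[]].
- by constructor 1.
- by move=> /existsP[u /andP[uS /existsP[i /eqP wu]]]; constructor 2; exists u => //; exists i.
- by move=> /existsP[i wv]; constructor 3; exists i.
- by move->.
- by move=> [u uS [i wu]]; apply/orP; left; apply/orP; right; apply/existsP; exists u;
    rewrite uS; apply/existsP; exists i; rewrite wu.
- by move=> [i wv]; apply/orP; right; apply/existsP; exists i.
Qed.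

Lemma sub_foldl_push_pull (S : {set V}) (ws : seq choices) :
  S \subset foldl (@push_pull V k) S ws.
Proof.
elim: ws S => //= w ws IH S; exact: subset_trans (sub_push_pull S w) (IH _).
Qed.

Lemma le_expects t f g : (forall ws, f ws <= g ws) -> expects t f <= expects t g.
Proof.
elim: t f g => //= t IH f g fg; apply: le_expect => w; exact: IH.
Qed.

Lemma eq_expects t f g : (forall ws, f ws = g ws) -> expects t f = expects t g.
Proof. by move=> fg; apply/eqP; rewrite eq_le !le_expects // => ws; rewrite fg. Qed.

Lemma expects_cst t c : expects t (fun=> c) = c.
Proof.
elim: t => //= t IH; rewrite -[RHS](@expect_cst R V E k); apply: eq_bigr => w _.
by rewrite IH.
Qed.

Lemma expectsD t f g : expects t (fun ws => f ws + g ws) = expects t f + expects t g.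
Proof.
elim: t f g => //= t IH f g; rewrite -expectD; apply: eq_bigr => w _; by rewrite IH.
Qed.

Lemma expects_sum t (I : finType) (f : I -> seq choices -> R) :
  expects t (fun ws => \sum_i f i ws) = \sum_i expects t (f i).
Proof.
elim: t f => //= t IH f; rewrite -expect_sum; apply: eq_bigr => w _; by rewrite IH.
Qed.

Lemma expects_cat t1 t2 f :
  expects (t1 + t2) f = expects t1 (fun u => expects t2 (fun v => f (u ++ v))).
Proof. by elim: t1 f => //= t1 IH f; apply: eq_bigr => w _; rewrite IH. Qed.

Lemma expects_tuple t f :
  expects t f = \sum_(ws : t.-tuple choices) f ws * \prod_(j < t) choices_pr E R (tnth ws j).
Proof.
elim: t f => [|t IH] f.
  rewrite (bigD1 [tuple]) //= big_ord0 mulr1 big1 ?addr0 // => ws /eqP[].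
  exact: tuple0.
transitivity (\sum_(w : choices) \sum_(ws : t.-tuple choices)
    choices_pr E R w * (f (w :: ws) * \prod_(j < t) choices_pr E R (tnth ws j))).
  by apply: eq_bigr => w _; rewrite -/expects IH mulr_sumr.
rewrite pair_big /= (reindex (fun p : choices * t.-tuple choices => [tuple of p.1 :: p.2])) /=.
  apply: eq_bigr => -[w ws] _ /=; rewrite big_ord_recl tnth0 mulrCA; congr (_ * (_ * _)).
  by apply: eq_bigr => j _; rewrite tnthS.
exists (fun ws : t.+1.-tuple choices => (thead ws, [tuple of behead ws])) => [[w ws] _|ws _] /=.
  by congr (_, _); apply: val_inj.
by rewrite [RHS]tuple_eta; apply: val_inj.
Qed.

(** Rounds are independent and identically distributed, so the weight of a sequence is invariant
    under permutation. This lets the second half of the process be run backwards. *)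
Lemma expects_rev t f : expects t (fun ws => f (rev ws)) = expects t f.
Proof.
rewrite !expects_tuple [RHS](reindex_inj (h := fun ws : t.-tuple choices => [tuple of rev ws])) /=.
  apply: eq_bigr => ws _; congr (_ * _).
  rewrite -(big_tuple _ _ ws predT (choices_pr E R)).
  rewrite -(big_tuple _ _ [tuple of rev ws] predT (choices_pr E R)).
  by apply: perm_big; rewrite perm_sym perm_rev.
by move=> u v /(congr1 val) /= /(can_inj revK) uv; apply: val_inj.
Qed.

Lemma Pr_expects t (A : pred (seq choices)) :
  Pr E R (fun ws : t.-tuple choices => A ws) = expects t (fun ws => (A ws)%:R).
Proof.
rewrite expects_tuple /Pr big_mkcond; apply: eq_bigr => ws _.
by case: (A ws); rewrite ?mul1r ?mul0r.
Qed.

Lemma prob_after_le1 t S Q : prob_after t S Q <= 1.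
Proof. by rewrite -(expects_cst t 1); apply: le_expects => ws; rewrite lern1 leq_b1. Qed.

Lemma le_prob_after t (S : {set V}) (Q Q' : pred {set V}) :
  (forall S' : {set V}, S \subset S' -> Q S' -> Q' S') -> prob_after t S Q <= prob_after t S Q'.
Proof.
move=> QQ'; apply: le_expects => ws; rewrite ler_nat.
have := QQ' _ (sub_foldl_push_pull S ws); case: (Q _) => // ->//.
Qed.

Lemma prob_after_pred0 t (S : {set V}) (Q : pred {set V}) :
  (forall S' : {set V}, S \subset S' -> ~~ Q S') -> prob_after t S Q = 0.
Proof.
move=> Q0; rewrite -[RHS](expects_cst t); apply: eq_expects => ws.
by rewrite (negbTE (Q0 _ (sub_foldl_push_pull S ws))).
Qed.

Lemma prob_after1 S Q : prob_after 1 S Q = prob (fun w => Q (push_pull S w)).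
Proof. by []. Qed.

(** Conditioning on the first [t1] rounds: either they miss the intermediate goal [G], or the
    remaining rounds fail with conditional probability at most [b]. *)
Lemma prob_after_add t1 t2 (S : {set V}) (G Q : pred {set V}) (b : R) : 0 <= b ->
  (forall S' : {set V}, S \subset S' -> G S' -> prob_after t2 S' Q <= b) ->
  prob_after (t1 + t2) S Q <= prob_after t1 S (fun S' => ~~ G S') + b.
Proof.
move=> b0 GQ; rewrite /prob_after expects_cat -[X in _ <= _ + X](expects_cst t1) -expectsD.
apply: le_expects => u.
under eq_expects do rewrite foldl_cat.
have := GQ _ (sub_foldl_push_pull S u); have := prob_after_le1 t2 (foldl (@push_pull V k) S u) Q.
by rewrite /prob_after; case: (G _) => /= [_ /(_ isT)|? _]; lra.
Qed.

Lemma prob_after_chain (Inv : nat -> pred {set V}) (eta : R) T (S : {set V}) : 0 <= eta ->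
  (forall t (S' : {set V}), (t < T)%N -> S \subset S' -> Inv t S' ->
    prob (fun w => ~~ Inv t.+1 (push_pull S' w)) <= eta) ->
  Inv 0 S -> prob_after T S (fun S' => ~~ Inv T S') <= T%:R * eta.
Proof.
move=> eta0; elim: T => [|T IH] step I0.
  by rewrite mul0r /prob_after /= I0.
rewrite -addn1; apply: (le_trans (prob_after_add T (G := Inv T) eta0 _)).
  by move=> S' SS' IS'; rewrite prob_after1 addn1; exact: step.
rewrite natrD mulrDl mul1r lerD2r IH // => t S' tT; apply: step; lia.
Qed.

(** Since [Q] is inherited by smaller sets, if it holds at the end it held after every round, and
    each round costs a factor [q]. *)
Lemma prob_after_stay t (S : {set V}) (Q : pred {set V}) (q : R) : 0 <= q ->
  (forall A B : {set V}, A \subset B -> Q B -> Q A) ->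
  (forall S' : {set V}, S \subset S' -> Q S' -> prob (fun w => Q (push_pull S' w)) <= q) ->
  prob_after t S Q <= q ^+ t.
Proof.
move=> q0 Qmono; elim: t S => [|t IH] S step.
  by rewrite expr0 prob_after_le1.
have h (w : choices) : prob_after t (push_pull S w) Q <= q ^+ t * (Q (push_pull S w))%:R.
  have [Qw|Qw] := boolP (Q (push_pull S w)); rewrite ?mulr1 ?mulr0.
    by apply: IH => S' hS'; apply: step; exact: subset_trans (sub_push_pull S w) hS'.
  rewrite prob_after_pred0 // => S' hS'; apply: contra Qw; exact: Qmono.
have [QS|QS] := boolP (Q S).
  rewrite exprSr; apply: (@le_trans _ _ (expect (fun w => q ^+ t * (Q (push_pull S w))%:R))).
    exact: le_expect.
  by rewrite expectZ ler_wpM2l ?exprn_ge0 // step.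
rewrite prob_after_pred0 ?exprn_ge0 // => S' hS'; apply: contra QS; exact: Qmono.
Qed.

(* Each success costs [tau] rounds and lowers the potential [Theta] by at least
   [tau], so at most [N + 1] attempts are made. *)
Lemma prob_after_descent (Theta : {set V} -> R) (P Tg : pred {set V}) (eta : R) :
  0 <= eta ->
  (forall A B : {set V}, A \subset B -> P A -> P B) ->
  (forall A B : {set V}, A \subset B -> Tg A -> Tg B) ->
  (forall S : {set V}, P S -> ~~ Tg S -> exists2 tau : nat, (0 < tau)%N & tau%:R <= Theta S /\
     prob_after tau S (fun S' => ~~ (Tg S' || (Theta S' + tau%:R <= Theta S))) <= eta) ->
  forall (N : nat) S, P S -> Theta S <= N%:R ->
  prob_after N S (fun S' => ~~ Tg S') <= N.+1%:R * eta.
Proof.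
move=> eta0 Pmono Tmono step N; elim/ltn_ind: N => N IH S PS ThS.
have N0 : 0 <= N.+1%:R * eta by rewrite mulr_ge0.
have [TS|TS] := boolP (Tg S).
  by rewrite prob_after_pred0 // => S' hS'; rewrite negbK; exact: Tmono TS.
have [tau tau0 [tauTh ptau]] := step S PS TS.
(* An attempt fits into the remaining budget because [tau] is at most the potential, which is at
   most [N]. *)
have tauN : (tau <= N)%N by rewrite -(ler_nat R); exact: le_trans ThS.
rewrite -(subnKC tauN).
have b0 : 0 <= (N - tau).+1%:R * eta by rewrite mulr_ge0.
apply: (le_trans (prob_after_add tau (G := fun S' => Tg S' || (Theta S' + tau%:R <= Theta S)) b0 _)).
  move=> S' SS' /orP[TS'|ThS'].
    by rewrite prob_after_pred0 // => S2 hS2; rewrite negbK; exact: Tmono TS'.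
  apply: IH; [lia|exact: Pmono PS|]; rewrite natrB //; lra.
rewrite subnKC //; have -> : N.+1%:R * eta = eta + N%:R * eta by rewrite -natr1; ring.
by apply: lerD => //; rewrite ler_wpM2r // ler_nat; lia.
Qed.

End Rounds.

(** * Avoidance and pull estimates for one round on a graph *)

Section GraphRound.
Variables (R : realType) (V : finType) (E : rel V) (k : nat).
Local Notation choices := (choices V k).
Local Notation prob := (@prob R V E k).
Local Notation sp := (sample_space E).

Definition nb (v : V) : {set V} := [set u | E v u].

Lemma nbhd_set1 v : nbhd E [set v] = nb v.
Proof.
apply/setP => u; rewrite !inE; apply/existsP/idP => [[x]|Evu].
  by rewrite inE => /andP[/eqP->].
by exists v; rewrite inE eqxx.
Qed.

Lemma in_nbhd (S : {set V}) u v : u \in S -> v \in nb u -> v \in nbhd E S.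
Proof. by rewrite !inE => uS Euv; apply/existsP; exists u; rewrite uS. Qed.

Lemma nbhdP (S : {set V}) v : reflect (exists2 u, u \in S & v \in nb u) (v \in nbhd E S).
Proof.
rewrite inE; apply: (iffP existsP) => [[u /andP[uS Euv]]|[u uS]].
  by exists u => //; rewrite inE.
by rewrite inE => Euv; exists u; rewrite uS.
Qed.

Lemma nbhdS (S S' : {set V}) : S \subset S' -> nbhd E S \subset nbhd E S'.
Proof.
move=> /subsetP SS'; apply/subsetP => v /nbhdP[u uS vu]; apply: in_nbhd vu; exact: SS'.
Qed.

Lemma nb_sub_nbhd (S : {set V}) u : u \in S -> nb u \subset nbhd E S.
Proof. by move=> uS; apply/subsetP => v; exact: in_nbhd. Qed.

Lemma sample_spaceE v : (0 < #|nb v|)%N -> sp v = nb v.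
Proof. by rewrite /sample_space nbhd_set1 card_gt0 => /negbTE->. Qed.

(** The two sides differ only at an isolated node, where division by zero makes the left side 0. *)
Lemma nb_avoid_ratio (X : {set V}) v :
  #|X :&: nb v|%:R / #|nb v|%:R <= #|X :&: sp v|%:R / #|sp v|%:R :> R.
Proof.
have [h|h] := posnP #|nb v|; last by rewrite sample_spaceE.
by rewrite h invr0 mulr0 divr_ge0.
Qed.

Lemma prob_avoid_nb (X : V -> {set V}) (A : pred choices) :
  (forall w, A w -> forall v i, w v i \notin X v) ->
  prob A <= expR (- (k%:R * \sum_v #|X v :&: nb v|%:R / #|nb v|%:R)).
Proof.
move=> AX; apply: (@le_trans _ _ (prob (fun w => [forall v, forall i, w v i \notin X v]))).
  by apply: le_prob => w Aw; apply/forallP => v; apply/forallP => i; exact: AX.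
apply: le_trans (prob_avoid R E k X) _.
rewrite ler_expR lerN2 ler_wpM2l //; apply: ler_sum => v _; exact: nb_avoid_ratio.
Qed.

(** Only the pushes of [P] are used: these nodes must avoid [H] with all their samples, the others
    are unconstrained. *)
Lemma prob_no_push (S P H : {set V}) : P \subset S ->
  prob (fun w => [disjoint H & push_pull S w])
    <= expR (- (k%:R * \sum_(u in P) #|H :&: nb u|%:R / #|nb u|%:R)).
Proof.
move=> /subsetP PS; pose X u := if u \in P then H else set0.
have -> : \sum_(u in P) #|H :&: nb u|%:R / #|nb u|%:R
    = \sum_u #|X u :&: nb u|%:R / #|nb u|%:R :> R.
  rewrite big_mkcond; apply: eq_bigr => u _; rewrite /X; case: ifP => // _.
  by rewrite set0I cards0 mul0r.
apply: prob_avoid_nb => w; rewrite disjoint_sym => /disjointFr dHw u i.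
rewrite /X; case: ifP => [uP|_]; last by rewrite inE.
by rewrite dHw //; apply/push_pullP; constructor 2; exists u; [exact: PS|exists i].
Qed.

Lemma prob_no_pull (S W : {set V}) :
  prob (fun w => [disjoint W & push_pull S w])
    <= expR (- (k%:R * \sum_(v in W) #|S :&: nb v|%:R / #|nb v|%:R)).
Proof.
pose X v := if v \in W then S else set0.
have -> : \sum_(u in W) #|S :&: nb u|%:R / #|nb u|%:R
    = \sum_u #|X u :&: nb u|%:R / #|nb u|%:R :> R.
  rewrite big_mkcond; apply: eq_bigr => u _; rewrite /X; case: ifP => // _.
  by rewrite set0I cards0 mul0r.
apply: prob_avoid_nb => w dHw v i.
rewrite /X; case: ifP => [vW|_]; last by rewrite inE.
by apply: contraFN (disjointFr dHw vW) => wS; apply/push_pullP; constructor 3; exists i.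
Qed.

(** The nodes whose expected number of samples in [S] exceeds [L]; each of them fails to pull with
    probability at most [expR (- L)]. *)
Definition saturated (L : R) (S : {set V}) : {set V} :=
  [set v | L * #|nb v|%:R < k%:R * #|S :&: nb v|%:R].

Lemma prob_saturated (L : R) (S : {set V}) : 0 <= L ->
  prob (fun w => ~~ (saturated L S \subset push_pull S w)) <= #|V|%:R * expR (- L).
Proof.
move=> L0.
apply: (@le_trans _ _ (\sum_(v in saturated L S) prob (fun w => [disjoint [set v] & push_pull S w]))).
  apply: (le_trans _ (@prob_exists R V E k V (mem (saturated L S))
    (fun v w => [disjoint [set v] & push_pull S w]))); apply: le_prob => w /subsetPn[v vs vw].
  by apply/existsP; exists v; apply/andP; split; [exact: vs|rewrite disjoints1].
apply: (@le_trans _ _ (\sum_(v in saturated L S) expR (- L))).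
  apply: ler_sum => v; rewrite inE => vs; apply: le_trans (prob_no_pull _ _) _.
  rewrite big_set1 ler_expR lerN2.
  have [d0|d0] := posnP #|nb v|.
    move: vs; rewrite d0 mulr0.
    suff -> : #|S :&: nb v| = 0%N by rewrite mulr0 ltxx.
    by apply/eqP; rewrite -leqn0 -d0 subset_leq_card // subsetIr.
  by rewrite mulrA ler_pdivlMr ?ltr0n // ltW.
rewrite sumr_const -[leLHS]mulr_natl ler_wpM2r ?expR_ge0 // ler_nat.
exact: max_card.
Qed.

Section Pulls.
Variables (S : {set V}) (m : nat) (K : V -> {set V}) (G : {set V}).
Hypothesis mk : (m <= k)%N.
Hypothesis KS : forall v, v \in G -> K v \subset S :&: nb v.
Hypothesis Kd : forall v, v \in G -> (m * #|K v| <= #|nb v|)%N.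

(** Counting only [m] samples and only the targets [K v], with [m * #|K v|] at most the degree,
    makes the success probability linear in [#|K v|] up to a factor 2, from both sides. *)
Definition pulls (w : choices) : {set V} :=
  [set v in G | [exists i : 'I_k, (i < m)%N && (w v i \in K v)]].

Lemma sub_pulls w : pulls w \subset push_pull S w.
Proof.
apply/subsetP => v; rewrite inE => /andP[vG /existsP[i /andP[_ wK]]].
apply/push_pullP; constructor 3; exists i.
by move/subsetP: (KS vG) => /(_ _ wK); rewrite inE => /andP[].
Qed.

Lemma node_prob_pulls v : v \in G ->
  m%:R * #|K v|%:R / (2 * #|nb v|%:R)
    <= node_prob R E v (fun g : {ffun 'I_k -> V} => (v \in G) && [exists i : 'I_k, (i < m)%N && (g i \in K v)])
    <= m%:R * #|K v|%:R / #|nb v|%:R.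
Proof.
move=> vG.
have -> : node_prob R E v (fun g : {ffun 'I_k -> V} => (v \in G) && [exists i : 'I_k, (i < m)%N && (g i \in K v)])
  = node_prob R E v (fun g : {ffun 'I_k -> V} => [exists i : 'I_k, (i < m)%N && (g i \in K v)]).
  by rewrite vG.
have Knb : K v \subset nb v by apply: subset_trans (KS vG) (subsetIr _ _).
have [d0|d0] := posnP #|nb v|.
  have K0 : K v = set0.
    by apply/eqP; rewrite -cards_eq0 -leqn0 -d0 subset_leq_card.
  have -> : node_prob R E v (fun g : {ffun 'I_k -> V} => [exists i : 'I_k, (i < m)%N && (g i \in K v)])
      = 0.
    rewrite -[RHS](node_expect_cst E k v); apply: eq_bigr => g _; congr (_ * _).
    by rewrite (_ : [exists i, _] = false) //; apply/existsP => -[i]; rewrite K0 inE andbF.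
  by rewrite K0 cards0 mulr0 !mul0r lexx.
rewrite -(sample_spaceE d0); apply: node_prob_pull_bounds => //.
  by rewrite sample_spaceE.
by rewrite sample_spaceE // Kd.
Qed.

Lemma pulls_lower (c p : V -> R) (M : R) : 0 < M ->
  (forall v, v \in G -> 0 <= c v <= M) ->
  (forall v, v \in G -> p v <= m%:R * #|K v|%:R / (2 * #|nb v|%:R)) ->
  prob (fun w => \sum_(v in pulls w) c v < (\sum_(v in G) c v * p v) / 4)
    <= expR (- ((\sum_(v in G) c v * p v) / (4 * M))).
Proof.
move=> M0 cM pK; pose c' v := if v \in G then c v else 0.
have -> : \sum_(v in G) c v * p v = \sum_v c' v * p v.
  by rewrite big_mkcond; apply: eq_bigr => v _; rewrite /c'; case: ifP => //; rewrite mul0r.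
pose a v := fun g : {ffun 'I_k -> V} => (v \in G) && [exists i : 'I_k, (i < m)%N && (g i \in K v)].
apply: (le_trans _ (@chernoff_lower R V E k a c' p M M0 _ _)).
- apply: le_prob => w.
  suff -> : \sum_(v in pulls w) c v = \sum_v c' v * (a v (w v))%:R by [].
  rewrite big_mkcond; apply: eq_bigr => v _; rewrite /a /c' inE.
  case: (v \in G) => /=; last by rewrite mul0r.
  by case: [exists i, _]; rewrite ?mulr1 ?mulr0.
- move=> v; rewrite /c'; case: ifP => [/cM//|_]; by rewrite lexx ltW.
- move=> v; rewrite /c'; case: ifP => [vG _|_]; last by rewrite ltxx.
  by have /andP[+ _] := node_prob_pulls vG; apply: le_trans; exact: pK.
Qed.

Lemma pulls_upper (Y : {set V}) (U : R) : Y \subset G ->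
  \sum_(v in Y) m%:R * #|K v|%:R / #|nb v|%:R <= U ->
  prob (fun w => 4 * U <= #|Y :&: pulls w|%:R) <= expR (- U).
Proof.
move=> /subsetP YG hU.
pose a v := fun g : {ffun 'I_k -> V} => (v \in Y) && ((v \in G) && [exists i : 'I_k, (i < m)%N && (g i \in K v)]).
apply: (le_trans _ (@chernoff_upper R V E k a U _)).
  apply: le_prob => w; suff -> : #|Y :&: pulls w|%:R = \sum_v (a v (w v))%:R :> R by [].
  rewrite -sum1_card natr_sum big_mkcond; apply: eq_bigr => v _.
  by rewrite /a !inE; case: (v \in Y) => //=; case: (_ && _).
apply: le_trans hU; rewrite [leRHS]big_mkcond; apply: ler_sum => v _; case: ifP => vY.
  have /andP[_] := node_prob_pulls (YG _ vY); apply: le_trans.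
  by apply: le_node_expect => g; rewrite /a vY.
rewrite -(node_expect_cst E k v 0); apply: le_node_expect => g.
by rewrite /a vY.
Qed.

End Pulls.

End GraphRound.

(** * The random walk from the boundary *)

Section Majority.
Variables (R : realType) (V : finType) (E : rel V) (S : {set V}).

Definition majority : {set V} := S :|: [set v | (#|nb E v| < 2 * #|S :&: nb E v|)%N].

(** The use of [majority]: once a node outside it is informed, half of its degree counts towards the
    new neighbourhood. *)
Lemma notin_majority v : v \notin majority -> #|nb E v|%:R / 2 <= #|nb E v :\: S|%:R :> R.
Proof.
rewrite !inE negb_or -leqNgt => /andP[_ h].
have := cardsID S (nb E v); rewrite setIC => e.
have : (#|nb E v| <= 2 * #|nb E v :\: S|)%N by lia.
rewrite -(ler_nat R) natrM; lra.
Qed.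

End Majority.

Section Flow.
Variables (R : realType) (V : finType) (E : rel V) (k k' : nat) (L : R).
Hypothesis Esym : symmetric E.
Hypothesis L1 : 1 <= L.
Hypothesis k'0 : (0 < k')%N.
Hypothesis kk' : 8 * L * k'%:R <= k%:R.
Variable S : {set V}.
Local Notation deg v := (#|nb E v|%:R : R).
Local Notation n := (#|V|%:R : R).

Local Notation majority := (majority E S).

Variable B : {set V}.
Hypothesis BS : B \subset nbhd E S.
Hypothesis B0 : (0 < #|B|)%N.

(** Growth of the mass per round. The 8 is a factor 2 lost in the pull probability times a factor 4
    between the mass and the number of informed neighbours. *)
Definition kap : R := k'%:R / 8.

(** Level 0 carries the indicator of [B], so with threshold 1 its thin nodes have no mass; on later
    levels concentration needs [L]. *)
Definition thr (j : nat) : R := if j is 0 then 1 else L.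

Definition thin (t : R) (x : V -> R) (z : V) : bool := (z \notin majority) && (x z < t).

(** The 8 exceeds the 4 that [inv] allows between mass and informed neighbours, so that full nodes
    are saturated ([full_saturated]). *)
Definition full (t : R) (x : V -> R) (z : V) : bool :=
  (z \in majority) || (t <= x z) && (8 * L * deg z < k%:R * x z).

Definition live (t : R) (x : V -> R) (z : V) : bool :=
  [&& z \notin majority, t <= x z & k%:R * x z <= 8 * L * deg z].

(* [mass j] is [kap ^ j * #|B|] times the distribution of the j-th step of a
   random walk started uniformly on [B] and killed where it is not [live]. *)
Fixpoint mass (j : nat) : V -> R :=
  if j is i.+1 then
    fun y => \sum_(z | live (thr i) (mass i) z && (y \in nb E z)) kap * mass i z / deg z
  else fun y => (y \in B)%:R.

Local Notation thinj j := (thin (thr j) (mass j)).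
Local Notation fullj j := (full (thr j) (mass j)).
Local Notation livej j := (live (thr j) (mass j)).

Lemma thr_ge1 j : 1 <= thr j. Proof. by case: j. Qed.

Lemma kap_gt0 : 0 < kap. Proof. by rewrite divr_gt0 // ltr0n. Qed.

Lemma k_gt0 : 0 < k%:R :> R.
Proof. by apply: lt_le_trans kk'; rewrite !mulr_gt0 ?ltr0n //; have := L1; lra. Qed.

Lemma L8k : 8 * L <= k%:R.
Proof.
apply: le_trans kk'; rewrite ler_peMr ?ler1n // mulr_ge0 //.
exact: le_trans L1.
Qed.

Lemma kap_le_k : kap <= k%:R.
Proof.
apply: le_trans kk'; rewrite /kap; have h : 0 <= k'%:R :> R by [].
have : k'%:R <= L * k'%:R by rewrite ler_peMl.
lra.
Qed.

Lemma mass_ge0 j y : 0 <= mass j y.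
Proof.
elim: j y => [|j IH] y /=; first exact: ler0n.
by apply: sumr_ge0 => z _; rewrite divr_ge0 // mulr_ge0 // ltW // kap_gt0.
Qed.

Lemma live_deg_gt0 j z : livej j z -> 0 < deg z.
Proof.
move=> /and3P[_ h1 h2]; have x0 := lt_le_trans ltr01 (le_trans (thr_ge1 j) h1).
rewrite ltr0n lt0n; apply/eqP => d0; move: h2.
by rewrite d0 mulr0 leNgt mulr_gt0 // k_gt0.
Qed.

Lemma thin_full_live j z : [|| thinj j z, fullj j z | livej j z].
Proof.
rewrite /thin /full /live; case: (z \in majority) => //=.
by case: ltP => //= _; case: ltP.
Qed.

(* Probability that the killed walk, started at [w] with [r] steps to go, does
   not meet a [full] node; the level of [w] is [J - r]. *)
Fixpoint esc (J r : nat) : V -> R :=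
  if r is r'.+1 then
    fun w => if livej (J - r) w then (\sum_(y in nb E w) esc J r' y) / deg w
             else (thinj (J - r) w)%:R
  else fun=> 1.

Lemma esc_ge0 J r w : 0 <= esc J r w.
Proof.
elim: r w => //= r IH w; case: ifP => // _; by rewrite divr_ge0 // sumr_ge0.
Qed.

(** Conservation of flow: mass on full nodes does not escape, mass on thin nodes stays, and live
    mass moves to the next level, multiplied by [kap]. *)
Lemma esc_step J r : (r < J)%N ->
  \sum_w mass (J - r.+1) w * esc J r.+1 w
    = \sum_(w | thinj (J - r.+1) w) mass (J - r.+1) w
      + kap^-1 * \sum_w mass (J - r) w * esc J r w.
Proof.
move=> rJ; have Jr : (J - r = (J - r.+1).+1)%N by move: rJ; clear; lia.
rewrite Jr; set j := (J - r.+1)%N.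
have -> : \sum_w mass j.+1 w * esc J r w
  = \sum_(z | livej j z) kap * mass j z / deg z * \sum_(y in nb E z) esc J r y.
  rewrite /= (eq_bigr (fun y => \sum_(z | livej j z) (if y \in nb E z then kap * mass j z / deg z * esc J r y else 0))).
    rewrite exchange_big; apply: eq_bigr => z _; rewrite mulr_sumr.
    by rewrite [RHS]big_mkcond; apply: eq_bigr => y _.
  by move=> y _; rewrite mulr_suml big_mkcondr; apply: eq_bigr => z _; case: ifP; rewrite ?mul0r.
rewrite mulr_sumr [X in _ = X + _]big_mkcond [X in _ = _ + X]big_mkcond -big_split /=.
apply: eq_bigr => w _; rewrite -/j; case: (boolP (livej j w)) => [lw|_].
  have -> : thinj j w = false.
    by move: lw => /and3P[h1 h2 _]; rewrite /thin h1 ltNge h2.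
  by rewrite add0r; field; rewrite (gt_eqF kap_gt0) (gt_eqF (live_deg_gt0 lw)).
by rewrite addr0; case: ifP; rewrite ?mulr1 ?mulr0.
Qed.

Lemma mass_out j (f : V -> R) :
  \sum_y f y * mass j.+1 y
    = \sum_(z | livej j z) kap * mass j z / deg z * \sum_(y in nb E z) f y.
Proof.
rewrite /= (eq_bigr (fun y => \sum_(z | livej j z) (if y \in nb E z then kap * mass j z / deg z * f y else 0))).
  rewrite exchange_big; apply: eq_bigr => z _; rewrite mulr_sumr.
  by rewrite [RHS]big_mkcond; apply: eq_bigr => y _.
move=> y _; rewrite mulr_sumr big_mkcondr; apply: eq_bigr => z _; case: ifP => _; rewrite ?mulr0 //.
by rewrite mulrC.
Qed.

(** A live node has mass at most its degree because [8 * L <= k], so the live mass on a level is at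
    most [n ^+ 2]. *)
Lemma sum_mass_le j : \sum_w mass j.+1 w <= kap * n ^+ 2.
Proof.
have -> : \sum_w mass j.+1 w = \sum_w 1 * mass j.+1 w by apply: eq_bigr => w _; rewrite mul1r.
rewrite mass_out (eq_bigr (fun z => kap * mass j z)); last first.
  move=> z lz; rewrite sumr_const -mulrA mulVf ?mulr1 //.
  by rewrite gt_eqF // (live_deg_gt0 lz).
rewrite -mulr_sumr ler_wpM2l ?(ltW kap_gt0) // expr2.
apply: (@le_trans _ _ (\sum_(z : V) n)); last by rewrite sumr_const mulr_natl.
rewrite big_mkcond; apply: ler_sum => z _; case: ifP => // /and3P[_ _ h].
apply: (@le_trans _ _ (deg z)); last by rewrite ler_nat max_card.
by rewrite -(ler_pM2l k_gt0); apply: le_trans h _; rewrite ler_wpM2r // L8k.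
Qed.

(** If no level loses much to thin nodes, at least [kap ^+ J * #|B| / 4] escaping mass reaches level
    [J], which contradicts [sum_mass_le]. *)
Lemma thin_level J : 4 * n ^+ 2 < kap ^+ J.-1 ->
  #|B|%:R / 2 <= \sum_w mass 0 w * esc J J w ->
  exists2 j, (0 < j < J)%N &
    (kap / 2) ^+ j * #|B|%:R / 8 <= \sum_(w | thinj j w) mass j w.
Proof.
move=> hJ hD.
have b1 : 1 <= #|B|%:R :> R by rewrite ler1n.
have n1 : 1 <= n by apply: le_trans b1 _; rewrite ler_nat max_card.
have J0 : (0 < J)%N.
  by case: J hJ {hD} => //=; rewrite expr0 expr2; nra.
have [/existsP[[j jJ] /= /andP[j0 hj]]|] := boolP [exists j : 'I_J, (0 < j)%N &&
    ((kap / 2) ^+ j * #|B|%:R / 8 <= \sum_(w | thinj j w) mass j w)].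
  by exists j => //; rewrite j0.
rewrite negb_exists => /forallP hno.
have hthin j : (j < J)%N -> \sum_(w | thinj j w) mass j w <= (kap / 2) ^+ j * #|B|%:R / 8.
  move=> jJ; have := hno (Ordinal jJ); rewrite negb_and -leqNgt leqn0 -ltNge /=.
  case/orP => [/eqP->|/ltW//]; rewrite big1 ?expr0 ?mul1r ?divr_ge0 // => w.
  by rewrite /thin /=; case: (w \in B) => //=; rewrite ltxx andbF.
(* The factor starts at 1/2 and loses [2^-1 ^+ j / 8] at level [j], in total less than 1/4. *)
have claim j : (j <= J)%N ->
    kap ^+ j * #|B|%:R * (4^-1 + 2^-1 ^+ j / 4) <= \sum_w mass j w * esc J (J - j) w.
  elim: j => [|j IH] jJ.
    by rewrite subn0 !expr0; apply: le_trans hD; rewrite mul1r mul1r; nra.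
  have := IH (ltnW jJ); have := hthin j jJ.
  have [e1 e2 e3 rJ] : [/\ (J - (J - j.+1).+1 = j)%N, ((J - j.+1).+1 = J - j)%N,
      (J - (J - j.+1) = j.+1)%N & (J - j.+1 < J)%N].
    by move: jJ; clear; split; lia.
  have := esc_step rJ; rewrite e1 e2 e3 => ->.
  set X := \sum_w mass j.+1 w * _; rewrite !exprS exprMn.
  set a := kap ^+ j; set h := 2^-1 ^+ j; set t := \sum_(w | thinj j w) _.
  have := kap_gt0 => kp ht hX.
  have : kap * (a * #|B|%:R * (4^-1 + h / 4) - a * h * #|B|%:R / 8) <= X.
    rewrite -ler_pdivlMl //; lra.
  by apply: le_trans; apply/eqP/eqP; lra.
have := claim J (leqnn J); rewrite subnn.
have : \sum_w mass J w * esc J 0 w <= kap * n ^+ 2.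
  by case: J J0 {hJ hD hno hthin claim} => // j _; under eq_bigr do rewrite mulr1; exact: sum_mass_le.
move=> h1 h2; have := le_trans h2 h1; rewrite leNgt => /negP[].
have kp := kap_gt0.
have : kap * n ^+ 2 < kap ^+ J * 4^-1.
  have -> : kap ^+ J * 4^-1 = kap * (kap ^+ J.-1 * 4^-1).
    by rewrite mulrA -exprS prednK.
  rewrite ltr_pM2l //; lra.
move=> h; apply: (lt_le_trans h).
have a0 : 0 <= kap ^+ J by rewrite exprn_ge0 // ltW.
have h0 : 0 <= 2^-1 ^+ J :> R by rewrite exprn_ge0 ?invr_ge0.
have c : 4^-1 <= #|B|%:R * (4^-1 + 2^-1 ^+ J / 4) :> R by nra.
by rewrite -mulrA; apply: ler_wpM2l.
Qed.

Definition subset_of_size (m : nat) (A : {set V}) : {set V} := [set v in take m (enum A)].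

Lemma subset_of_size_sub m A : subset_of_size m A \subset A.
Proof. by apply/subsetP => v; rewrite inE => /mem_take; rewrite mem_enum. Qed.

Lemma card_subset_of_size m A : #|subset_of_size m A| = minn m #|A|.
Proof.
rewrite cardsE (card_uniqP _) ?take_uniq ?enum_uniq // size_take_min.
by rewrite -cardE.
Qed.

Local Notation fullset j := [set v | fullj j v].

(** Failure probability of a round: two union bounds over the nodes, one for the saturated nodes and
    one for the concentration of the next masses. *)
Definition fail_pr : R := 2 * n * expR (- (L / 4)).

Lemma fail_pr_ge0 : 0 <= fail_pr.
Proof. by rewrite /fail_pr mulr_ge0 ?expR_ge0 // mulr_ge0. Qed.

Lemma saturated_fail_pr : n * expR (- L) <= fail_pr.
Proof.
rewrite /fail_pr -mulrA mulrCA ler_wpM2l //; have := expR_ge0 (- (L / 4)).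
have : expR (- L) <= expR (- (L / 4)) by rewrite ler_expR; have := L1; lra.
lra.
Qed.

(* At level 0 the flow leaves [S], which lies inside [majority]. *)
Definition inv (t : nat) (S' : {set V}) : bool :=
  [forall y, ((y \notin majority) && (thr t <= mass t y)) ==>
     (mass t y <= 4 * #|nb E y :&: (S' :\: (if t is 0 then set0 else majority))|%:R)]
  && [forall i : 'I_t, fullset i \subset S'].

Lemma inv_mass t S' y : inv t S' -> y \notin majority -> thr t <= mass t y ->
  mass t y <= 4 * #|nb E y :&: (S' :\: (if t is 0 then set0 else majority))|%:R.
Proof. by move=> /andP[/forallP/(_ y)/implyP h _] h1 h2; apply: h; rewrite h1. Qed.

Lemma inv_mass_nb t S' y : inv t S' -> y \notin majority -> thr t <= mass t y ->
  mass t y <= 4 * #|S' :&: nb E y|%:R.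
Proof.
move=> h h1 h2; apply: le_trans (inv_mass h h1 h2) _.
by rewrite ler_wpM2l // ler_nat setIC subset_leq_card // setSI // subsetDl.
Qed.

Lemma nbC u v : (u \in nb E v) = (v \in nb E u).
Proof. by rewrite !inE Esym. Qed.

Lemma inv0 : inv 0 S.
Proof.
apply/andP; split; last by apply/forallP => -[].
apply/forallP => y; apply/implyP => /andP[_]; rewrite /= setD0.
have [yB _|_] := boolP (y \in B); last by rewrite mulr0n ler10.
 have /nbhdP[u uS yu] := subsetP BS _ yB.
have : 1 <= #|nb E y :&: S|%:R :> R.
  by rewrite ler1n; apply/card_gt0P; exists u; rewrite inE nbC yu.
by rewrite mulr1n; lra.
Qed.

Lemma majority_saturated (S' : {set V}) : S \subset S' ->
  majority \subset S' :|: saturated E k L S'.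
Proof.
move=> SS'; apply/subsetP => v; rewrite in_setU inE => /orP[/(subsetP SS')->//|].
rewrite inE => hv; apply/orP; right; rewrite inE.
have hc : (#|S :&: nb E v| <= #|S' :&: nb E v|)%N by rewrite subset_leq_card // setSI.
have : (#|nb E v| < 2 * #|S' :&: nb E v|)%N by apply: leq_trans hv _; rewrite leq_mul2l hc.
rewrite -(ltr_nat R) natrM => hd; have c0 := ler0n R #|S' :&: nb E v|.
have L0 : 0 < L := lt_le_trans ltr01 L1.
have h8 := ler_wpM2r c0 L8k; rewrite -(ltr_pM2l L0) in hd.
have := mulr_ge0 (ltW L0) c0; lra.
Qed.

Lemma full_saturated t (S' : {set V}) : S \subset S' -> inv t S' ->
  fullset t \subset S' :|: saturated E k L S'.
Proof.
move=> SS' hinv; apply/subsetP => v; rewrite inE /full.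
have [vm _|vm] /= := boolP (v \in majority); first exact: subsetP (majority_saturated SS') v vm.
move=> /andP[h1 h2]; rewrite in_setU; apply/orP; right; rewrite inE.
have h := ler_wpM2l (ltW k_gt0) (inv_mass_nb hinv vm h1).
have : 0 <= L * deg v by rewrite mulr_ge0 // (le_trans ler01).
lra.
Qed.

Section Quota.
Variables (t : nat) (S' : {set V}).
Hypothesis hinv : inv t S'.

(* Restricting [z] to [k'] of its samples and to this many informed neighbours
   keeps its probability to be informed comparable to [kap * mass t z / deg z]
   from above as well as from below. *)
Definition quota (z : V) : {set V} :=
  subset_of_size (Num.truncn (mass t z)) (S' :&: nb E z).

Lemma quota_sub z : quota z \subset S' :&: nb E z.
Proof. exact: subset_of_size_sub. Qed.

Lemma quota_bounds z : livej t z -> mass t z / 4 <= #|quota z|%:R <= mass t z.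
Proof.
move=> /and3P[zm hz _]; have x1 := le_trans (thr_ge1 t) hz.
have h := inv_mass_nb hinv zm hz.
have /andP[t1 t2] := truncn_itv (mass_ge0 t z).
(* The mass of a live node is at least 1, so truncation at most halves it. *)
have tn1 : 1 <= (Num.truncn (mass t z))%:R :> R.
  by rewrite ler1n truncn_gt0.
rewrite -natr1 in t2.
rewrite card_subset_of_size natr_min /Order.min /= ; case: ltP => hm; apply/andP; split; lra.
Qed.

Lemma k'_mass z : livej t z -> k'%:R * mass t z <= deg z.
Proof.
move=> /and3P[_ _ h].
have L8 : 0 < 8 * L by have := L1; lra.
rewrite -(ler_pM2l L8) mulrA; apply: le_trans h; apply: ler_wpM2r; [exact: mass_ge0|exact: kk'].
Qed.

Lemma quota_deg z : livej t z -> (k' * #|quota z| <= #|nb E z|)%N.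
Proof.
move=> lz; rewrite -(ler_nat R) natrM; apply: le_trans (k'_mass lz).
by rewrite ler_wpM2l //; have /andP[] := quota_bounds lz.
Qed.

Lemma quota_lower z : livej t z ->
  kap * mass t z / deg z <= k'%:R * #|quota z|%:R / (2 * deg z).
Proof.
move=> lz; have d0 := live_deg_gt0 lz; have /andP[h _] := quota_bounds lz.
rewrite ler_pdivlMr ?mulr_gt0 //.
have -> : kap * mass t z / deg z * (2 * deg z) = k'%:R * (mass t z / 4).
  by rewrite /kap; field; rewrite gt_eqF.
exact: ler_wpM2l.
Qed.

Lemma quota_upper z : livej t z ->
  k'%:R * #|quota z|%:R / deg z <= 8 * (kap * mass t z / deg z).
Proof.
move=> lz; have d0 := live_deg_gt0 lz; have /andP[_ h] := quota_bounds lz.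
have -> : 8 * (kap * mass t z / deg z) = k'%:R * mass t z / deg z.
  by rewrite /kap; field; rewrite gt_eqF.
by rewrite ler_wpM2r ?invr_ge0 // ler_wpM2l.
Qed.

End Quota.

Lemma k'_le_k : (k' <= k)%N.
Proof.
rewrite -(ler_nat R); apply: le_trans kk'; rewrite ler_peMl //; have := L1; lra.
Qed.

Lemma mass_succ t y :
  mass t.+1 y = \sum_(z in [set z | livej t z]) (z \in nb E y)%:R * (kap * mass t z / deg z).
Proof.
rewrite /= big_mkcondr; apply: eq_big => [z|z _]; first by rewrite inE.
by rewrite nbC; case: ifP; rewrite ?mul1r ?mul0r.
Qed.

(** Live nodes that pull through their quota lie outside [majority] and are independent; a node [y]
    expects at least [mass t.+1 y] of them among its neighbours. As this mass is at least [L], a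
    quarter of it is attained except with probability [expR (- (L / 4))]. Full nodes are saturated
    and pull. *)
Lemma inv_step t (S' : {set V}) : S \subset S' -> inv t S' ->
  prob R E (fun w : choices V k => ~~ inv t.+1 (push_pull S' w)) <= fail_pr.
Proof.
move=> SS' hinv; pose G := [set z | livej t z]; pose pl (w : choices V k) := pulls k' (quota t S') G w.
pose bad y := (y \notin majority) && (L <= mass t.+1 y).
pose low y (w : choices V k) := \sum_(z in pl w) (z \in nb E y)%:R < mass t.+1 y / 4.
apply: (@le_trans _ _ (prob R E (fun w : choices V k => ~~ (saturated E k L S' \subset push_pull S' w)
          || [exists y, bad y && low y w]))).
  apply: le_prob => w; apply: contraR; rewrite negb_or negbK => /andP[hsat].
  rewrite negb_exists => /forallP hlow.
  have plS z : z \in pl w -> z \in push_pull S' w.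
    by apply/subsetP; apply: sub_pulls => v _; exact: quota_sub.
  apply/andP; split; apply/forallP.
    move=> y; apply/implyP => /andP[ym hy].
    have := hlow y; rewrite /bad ym hy /= -leNgt => h.
    have : \sum_(z in pl w) (z \in nb E y)%:R
        <= #|nb E y :&: (push_pull S' w :\: majority)|%:R :> R.
      rewrite -sum1_card natr_sum [leRHS]big_mkcond [leLHS]big_mkcond; apply: ler_sum => z _.
      case: ifP => [zp|_]; last by case: ifP.
      rewrite 2!inE [z \in _ :\: _]inE plS //.
      have : livej t z by move: zp; rewrite !inE => /andP[].
      by move=> /and3P[-> _ _]; rewrite andbT inE; case: (E y z).
    move=> h2; change (mass t.+1 y <= 4 * #|nb E y :&: (push_pull S' w :\: majority)|%:R).
    by rewrite /low -/(mass t.+1) in h; lra.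
  move=> [i /= it]; have [->|it'] := eqVneq i t.
    apply: subset_trans (full_saturated SS' hinv) _; rewrite subUset hsat andbT.
    exact: sub_push_pull.
  have it2 : (i < t)%N by rewrite ltn_neqAle it' -ltnS.
  have /andP[_ /forallP /(_ (Ordinal it2)) hf] := hinv.
  exact: subset_trans hf (sub_push_pull _ _).
have h1 : prob R E (fun w : choices V k => ~~ (saturated E k L S' \subset push_pull S' w))
    <= n * expR (- (L / 4)).
  apply: le_trans (prob_saturated _ _ _ _) _; first by have := L1; lra.
  by rewrite ler_wpM2l // ler_expR; have := L1; lra.
have h2 : prob R E (fun w : choices V k => [exists y, bad y && low y w])
    <= n * expR (- (L / 4)).
  apply: (le_trans (@prob_exists R V E k V bad low)).
  apply: (@le_trans _ _ (\sum_(y : V) expR (- (L / 4)))); last first.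
    by rewrite sumr_const mulr_natl.
  rewrite big_mkcond; apply: ler_sum => y _; case: ifP => [/andP[ym hy]|_]; last exact: expR_ge0.
  rewrite /low mass_succ.
  apply: le_trans (@pulls_lower R V E k S' k' (quota t S') G k'_le_k _ _
    (fun z => (z \in nb E y)%:R) (fun z => kap * mass t z / deg z) 1 _ _ _) _ => //.
  - by move=> z _; exact: quota_sub.
  - by move=> z; rewrite inE; exact: quota_deg.
  - by move=> z _; case: (_ \in _); rewrite lexx ler01.
  - by move=> z; rewrite inE; exact: quota_lower.
  - by rewrite -mass_succ ler_expR mulr1 lerN2 ler_pM2r ?invr_gt0.
apply: (le_trans (@prob_or R V E k (fun w => ~~ (saturated E k L S' \subset push_pull S' w))
  (fun w => [exists y, bad y && low y w]))).
apply: (le_trans (lerD h1 h2)).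
rewrite /fail_pr; lra.
Qed.
(** While time advances by [i] rounds, the walk is followed back from level [J] to level [J - i];
    each round costs [L / k] in the escape probability of uninformed nodes. *)
Definition inv_back (J i : nat) (S' : {set V}) : bool :=
  [forall j : 'I_J, fullset j \subset S']
  && [forall w, (w \notin S') ==> (1 - i%:R * (L / k%:R) <= esc J i w)].

Lemma inv_back0 J S' : inv J S' -> inv_back J 0 S'.
Proof.
move=> /andP[_ h]; rewrite /inv_back h; apply/forallP => w; apply/implyP => _ /=; lra.
Qed.

(** A node still uninformed after the round was not saturated, so at most a fraction [L / k] of its
    neighbours was informed before; the others satisfy the old bound, and [esc] averages over them.
    If the node is not live, it is not full either, hence thin. *)
Lemma inv_back_step J i (S' : {set V}) : (i < J)%N -> inv_back J i S' ->
  prob R E (fun w : choices V k => ~~ inv_back J i.+1 (push_pull S' w)) <= fail_pr.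
Proof.
move=> iJ /andP[/forallP hfull /forallP hesc].
have L0 : 0 <= L by have := L1; lra.
apply: le_trans (le_trans (prob_saturated E k S' L0) saturated_fail_pr).
apply: le_prob => w; apply: contraNN => /subsetP hsat; apply/andP; split.
  by apply/forallP => j; apply: subset_trans (hfull j) (sub_push_pull _ _).
apply/forallP => v; apply/implyP => vw; rewrite [esc _ _]/=; set j := (J - i.+1)%N.
have k0 := k_gt0; set q := L / k%:R; have q0 : 0 <= q by rewrite divr_ge0 // ltW.
have jJ : (j < J)%N by rewrite /j; move: iJ; clear; lia.
have vS' : v \notin S' by apply: contra vw; apply: subsetP (sub_push_pull _ _) v.
have vfull : ~~ fullj j v.
  by apply: contra vS' => hv; have := subsetP (hfull (Ordinal jJ)) v; rewrite inE; apply.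
have iq : 0 <= i.+1%:R * q by rewrite mulr_ge0.
case: ifPn => [lv|lv]; last first.
  have := thin_full_live j v; rewrite (negbTE vfull) (negbTE lv) !orbF => ->.
  by rewrite mulr1n; lra.
have d0 := live_deg_gt0 lv.
have vsat : v \notin saturated E k L S' by apply: contra vw; exact: hsat.
have hfrac : #|S' :&: nb E v|%:R <= q * deg v.
  by move: vsat; rewrite inE -leNgt /q mulrAC ler_pdivlMr // mulrC.
rewrite ler_pdivlMr //.
have [neg|pos] := ltP (1 - i%:R * q) 0.
  apply: (@le_trans _ _ 0); last by apply: sumr_ge0 => y _; exact: esc_ge0.
  by rewrite pmulr_lle0 // -natr1; lra.
apply: (@le_trans _ _ (\sum_(y in nb E v :\: S') (1 - i%:R * q))); last first.
  rewrite big_mkcond [leRHS]big_mkcond; apply: ler_sum => y _; rewrite in_setD.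
  case: (boolP (y \in S')) => /= [_|yS']; first by case: ifP => // _; exact: esc_ge0.
  by case: ifP => // _; have /implyP := hesc y; apply.
rewrite sumr_const -[leRHS]mulr_natr.
have -> : #|nb E v :\: S'|%:R = deg v - #|S' :&: nb E v|%:R :> R.
  by rewrite setIC -(cardsID S' (nb E v)) natrD; ring.
have h := ler_wpM2l pos hfrac; rewrite -natr1.
have := mulr_ge0 (mulr_ge0 (ler0n R i) (mulr_ge0 q0 q0)) (ltW d0); lra.
Qed.

(** [J] rounds forwards inform the full nodes of all levels below [J], and [J] rounds backwards give
    every uninformed node of [B] an escape probability of at least 3/4. As the average over [B] is
    below 1/2, less than 2/3 of [B] is uninformed. *)
Lemma prob_gain J : \sum_w mass 0 w * esc J J w < #|B|%:R / 2 -> 4 * J%:R * L <= k%:R ->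
  prob_after R E k (J + J) S (fun S' => (4 * #|B :&: S'| < #|B|)%N) <= (J + J)%:R * fail_pr.
Proof.
move=> hD hJ.
have h2 (S' : {set V}) : S \subset S' -> inv J S' ->
    prob_after R E k J S' (fun S' => ~~ inv_back J J S') <= J%:R * fail_pr.
  move=> SS' /inv_back0; apply: prob_after_chain; first exact: fail_pr_ge0.
  by move=> i S2 iJ _; exact: inv_back_step.
have h1 : prob_after R E k J S (fun S' => ~~ inv J S') <= J%:R * fail_pr.
  apply: prob_after_chain inv0; first exact: fail_pr_ge0.
  by move=> i S2 _; exact: inv_step.
have b0 : 0 <= J%:R * fail_pr by rewrite mulr_ge0 // fail_pr_ge0.
apply: le_trans (le_trans (prob_after_add J b0 h2) _); last by rewrite natrD mulrDl lerD2r.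
apply: le_prob_after => S' SS'; apply: contraL => /andP[_ /forallP hesc].
rewrite -leqNgt.
have k0 := k_gt0.
have Jq : J%:R * (L / k%:R) <= 4^-1 by rewrite mulrA ler_pdivrMr //; lra.
have hB : \sum_w mass 0 w * esc J J w = \sum_(w in B) esc J J w.
  by rewrite [RHS]big_mkcond; apply: eq_bigr => w _ /=; case: (w \in B); rewrite ?mul1r ?mul0r.
have : #|B :\: S'|%:R * (3 / 4) <= \sum_(w in B) esc J J w.
  rewrite mulr_natl -sumr_const big_mkcond [leRHS]big_mkcond; apply: ler_sum => w _.
  rewrite in_setD; case: (boolP (w \in S')) => /= [_|wS']; first by case: ifP => // _; exact: esc_ge0.
  by case: ifP => // _; have /implyP/(_ wS') := hesc w; lra.
rewrite -hB => h3; have := le_lt_trans h3 hD => h4.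
rewrite -(ler_nat R) natrM -(cardsID S' B) natrD.
move: h4; rewrite -(cardsID S' B) natrD; have := ler0n R #|B :&: S'|; have := ler0n R #|B :\: S'|; lra.
Qed.

Lemma flow_out j (Y : {set V}) :
  \sum_(y in Y) mass j.+1 y
    = \sum_(z in [set z | livej j z]) #|nb E z :&: Y|%:R * (kap * mass j z / deg z).
Proof.
transitivity (\sum_y (y \in Y)%:R * mass j.+1 y).
  by rewrite big_mkcond; apply: eq_bigr => y _; case: ifP; rewrite ?mul1r ?mul0r.
rewrite mass_out; apply: eq_big => [z|z _]; first by rewrite inE.
rewrite mulrC; congr (_ * _).
rewrite -sum1_card natr_sum big_mkcond [RHS]big_mkcond; apply: eq_bigr => y _.
by rewrite in_setI; case: (_ \in nb _ _); case: (_ \in Y).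
Qed.

Section Expand.
Variables (j : nat) (S' : {set V}) (M : R).
Hypothesis hinv : inv j S'.
Hypothesis M0 : 0 < M.
Let Y : {set V} := [set y | thinj j.+1 y].
Hypothesis hM : 256 * L * M <= \sum_(y in Y) mass j.+1 y.
Let mu := \sum_(y in Y) mass j.+1 y.
Let G : {set V} := [set z | livej j z].
Let hi : {set V} := [set z in G | 2 * M <= deg z].
Let lo : {set V} := [set z in G | deg z < 2 * M].
Local Notation flux z := (#|nb E z :&: Y|%:R * (kap * mass j z / deg z)).
Local Notation new_nbhd S' := (#|nbhd E S' :\: S|%:R : R).

(** Degrees below [2 * M] make the number of edges from pulling nodes to [Y] concentrated, hence at
    least [mu / 8]. A thin node of [Y] receives at most [32 * L] of them, so at least [M] distinct
    nodes of [Y] are reached; this gives 256. *)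
Lemma expand_low : mu / 2 <= \sum_(z in lo) flux z ->
  prob R E (fun w : choices V k => new_nbhd (push_pull S' w) < M) <= fail_pr.
Proof.
move=> hlo; have L0 : 0 < L := lt_le_trans ltr01 L1.
have loG z : z \in lo -> livej j z by rewrite !inE => /andP[].
pose pl (w : choices V k) := pulls k' (quota j S') lo w.
pose few w := \sum_(z in pl w) #|nb E z :&: Y|%:R < (\sum_(z in lo) flux z) / 4.
(* The 8 comes from [quota_upper], the 4 from [chernoff_upper]. *)
pose many y w := 4 * (8 * L) <= #|(lo :&: nb E y) :&: pl w|%:R.
have plG w z : z \in pl w -> z \in lo by rewrite inE => /andP[].
have hfew : prob R E few <= expR (- (L / 4)).
  apply: le_trans (@pulls_lower R V E k S' k' (quota j S') lo k'_le_k _ _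
    (fun z => #|nb E z :&: Y|%:R) (fun z => kap * mass j z / deg z) (2 * M) _ _ _) _.
  - by move=> z _; exact: quota_sub.
  - by move=> z /loG; exact: quota_deg.
  - by rewrite mulr_gt0.
  - move=> z; rewrite inE => /andP[_ /ltW h]; rewrite ler0n /=; apply: le_trans h.
    by rewrite ler_nat subset_leq_card // subsetIl.
  - by move=> z /loG; exact: quota_lower.
  - rewrite ler_expR lerN2 ler_pdivlMr ?mulr_gt0 //.
    have := mulr_gt0 L0 M0; have := hM; rewrite -/mu; lra.
have hmany y : y \in Y -> prob R E (many y) <= expR (- (8 * L)).
  rewrite inE => /andP[_ hy]; apply: pulls_upper.
  - exact: k'_le_k.
  - by move=> z _; exact: quota_sub.
  - by move=> z /loG; exact: quota_deg.
  - exact: subsetIl.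
  apply: (@le_trans _ _ (8 * mass j.+1 y)); last by rewrite ler_wpM2l // ltW.
  rewrite mass_succ mulr_sumr [leLHS]big_mkcond [leRHS]big_mkcond; apply: ler_sum => z _.
  rewrite in_setI; case: (boolP (z \in lo)) => zlo /=; last first.
    case: ifP => // zG; rewrite mulr_ge0 // mulr_ge0 // divr_ge0 // mulr_ge0 ?mass_ge0 //.
    exact: ltW kap_gt0.
  have -> : z \in [set z | livej j z] by rewrite inE loG.
  case: ifP => _; rewrite ?mul0r ?mulr0 // mul1r.
  by apply: quota_upper => //; exact: loG.
apply: (@le_trans _ _ (prob R E (fun w => few w || [exists y, (y \in Y) && many y w]))).
  apply: le_prob => w; apply: contraTT; rewrite negb_or negb_exists -!leNgt => /andP[hf /forallP hm].
  pose C := Y :&: nbhd E (pl w).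
  have hC : \sum_(z in pl w) #|nb E z :&: Y|%:R <= 32 * L * #|C|%:R :> R.
    have -> : \sum_(z in pl w) #|nb E z :&: Y|%:R = \sum_(y in C) #|nb E y :&: pl w|%:R :> R.
      transitivity (\sum_(z in pl w) \sum_(y in C) (y \in nb E z)%:R : R).
        apply: eq_bigr => z zp; rewrite -sum1_card natr_sum big_mkcond [RHS]big_mkcond.
        apply: eq_bigr => y _; rewrite !in_setI; case: (boolP (y \in nb E z)) => yz /=.
          by rewrite (in_nbhd zp yz) andbT; case: ifP.
        by case: ifP.
      rewrite exchange_big; apply: eq_bigr => y _.
      rewrite -sum1_card natr_sum big_mkcond [RHS]big_mkcond; apply: eq_bigr => z _.
      by rewrite in_setI nbC; case: (z \in pl w); case: (_ \in nb _ _).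
    rewrite mulr_natr -sumr_const; apply: ler_sum => y; rewrite in_setI => /andP[yY _].
    have := hm y; rewrite yY /= /many -ltNge => h; apply: ltW.
    suff -> : nb E y :&: pl w = lo :&: nb E y :&: pl w by lra.
    have plo : pl w \subset lo by apply/subsetP => z; exact: plG.
    by rewrite setIAC (setIidPr plo) setIC.
  apply: (@le_trans _ _ #|C|%:R); last first.
    rewrite ler_nat subset_leq_card //; apply/subsetP => y; rewrite in_setI => /andP[yY yn].
    rewrite in_setD; apply/andP; split.
      by move: yY; rewrite inE => /andP[ym _]; apply: contra ym; rewrite in_setU => ->.
    apply: subsetP yn; apply: nbhdS; apply: sub_pulls => z _; exact: quota_sub.
  have := hM; rewrite -/mu => hM'; rewrite -(ler_pM2l L0).
  lra.
apply: (le_trans (@prob_or R V E k few (fun w => [exists y, (y \in Y) && many y w]))).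
have hex : prob R E (fun w => [exists y, (y \in Y) && many y w]) <= n * expR (- (L / 4)) - expR (- (L / 4)) + expR (- (L / 4)).
  rewrite subrK.
  apply: (le_trans (@prob_exists R V E k V (mem Y) many)).
  apply: (@le_trans _ _ (\sum_(y : V) expR (- (L / 4)))); last first.
    by rewrite sumr_const mulr_natl.
  rewrite big_mkcond; apply: ler_sum => y _; case: ifP => [yY|_]; last exact: expR_ge0.
  by apply: le_trans (hmany y yY) _; rewrite ler_expR; lra.
have n1 : 1 <= n.
  rewrite ler1n; apply: leq_trans B0 _; exact: max_card.
have := lerD hfew hex; rewrite subrK /fail_pr; have := expR_ge0 (- (L / 4)); nra.
Qed.

(** One informed node of degree at least [2 * M] outside [majority] suffices. Either [P] contains
    one, or all nodes of [P] have smaller degree and their pushes hit [hi] with high probability.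
    For [0 < j] the invariant places the informed neighbours of [hi] in [P]. *)
Lemma expand_high : (0 < j)%N -> mu / 2 <= \sum_(z in hi) flux z ->
  prob R E (fun w : choices V k => new_nbhd (push_pull S' w) < M) <= fail_pr.
Proof.
move=> j0 hhi; have L0 : 0 < L := lt_le_trans ltr01 L1.
pose P := S' :\: majority.
have win (S2 : {set V}) z : z \in S2 -> z \notin majority -> 2 * M <= deg z ->
    M <= new_nbhd S2.
  move=> zS zm hz; apply: le_trans (le_trans _ (notin_majority R zm)) _; first lra.
  by rewrite ler_nat subset_leq_card // setSD // nb_sub_nbhd.
have [/existsP[u /andP[uP hu]]|] := boolP [exists u, (u \in P) && (2 * M <= deg u)].
  rewrite prob_pred0 ?fail_pr_ge0 // => w; rewrite -leNgt.
  move: uP; rewrite in_setD => /andP[um uS'].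
  apply: (win _ u) => //; exact: subsetP (sub_push_pull _ _) u uS'.
rewrite negb_exists => /forallP hP.
apply: (@le_trans _ _ (prob R E (fun w : choices V k => [disjoint hi & push_pull S' w]))).
  apply: le_prob => w; apply: contraTT => /pred0Pn[z /= /andP[+ zS]].
  rewrite inE => /andP[]; rewrite inE => /and3P[zm _ _] hz.
  by rewrite -leNgt; apply: (win _ z).
apply: le_trans (prob_no_push _ E k hi (subsetDl S' majority)) _; rewrite -/P.
apply: le_trans saturated_fail_pr; apply: (@le_trans _ _ (expR (- L))); last first.
  rewrite ler_peMl ?expR_ge0 // ler1n; apply: leq_trans B0 _; exact: max_card.
rewrite ler_expR lerN2.
have M20 : 0 < 2 * M by rewrite mulr_gt0.
have hsum : \sum_(z in hi) mass j z / 4 <= \sum_(u in P) #|hi :&: nb E u|%:R.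
  apply: (@le_trans _ _ (\sum_(z in hi) #|nb E z :&: P|%:R)).
    apply: ler_sum => z; rewrite inE => /andP[]; rewrite inE => /and3P[zm hz _] _.
    have := inv_mass hinv zm hz; rewrite (_ : (if j is 0 then set0 else majority) = majority).
      by rewrite -/P; lra.
    by case: j j0.
  have -> : \sum_(z in hi) #|nb E z :&: P|%:R = \sum_(z in hi) \sum_(u in P) (u \in nb E z)%:R :> R.
    apply: eq_bigr => z _; rewrite -sum1_card natr_sum big_mkcond [RHS]big_mkcond.
    by apply: eq_bigr => u _; rewrite in_setI; case: (u \in P); case: (_ \in nb _ _).
  rewrite exchange_big; apply: ler_sum => u _.
  rewrite -sum1_card natr_sum big_mkcond [leRHS]big_mkcond; apply: ler_sum => z _.
  by rewrite in_setI nbC; case: (z \in hi); case: (_ \in nb _ _).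
have hmass : mu / 2 <= kap * \sum_(z in hi) mass j z.
  apply: (le_trans hhi); rewrite mulr_sumr; apply: ler_sum => z; rewrite inE => /andP[].
  rewrite inE => lz _; have d0 := live_deg_gt0 lz; rewrite mulrA ler_pdivrMr // mulrC.
  apply: ler_wpM2l; first by rewrite mulr_ge0 ?mass_ge0 // ltW // kap_gt0.
  by rewrite ler_nat subset_leq_card // subsetIl.
have hfrac : (\sum_(u in P) #|hi :&: nb E u|%:R) / (2 * M)
    <= \sum_(u in P) #|hi :&: nb E u|%:R / deg u.
  rewrite mulr_suml; apply: ler_sum => u uP; have := hP u; rewrite uP /= -ltNge => hu.
  have [d0|d0] := posnP #|nb E u|.
    have -> : #|hi :&: nb E u| = 0%N.
      by apply/eqP; rewrite -leqn0 -d0 subset_leq_card // subsetIr.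
    by rewrite !mul0r.
  by rewrite ler_wpM2l // lef_pV2 ?posrE ?ltr0n // ltW.
apply: le_trans (ler_wpM2l (ltW k_gt0) hfrac); rewrite mulrA ler_pdivlMr //.
rewrite -mulr_suml in hsum; set X := \sum_(z in hi) mass j z in hsum hmass.
have X0 : 0 <= X by apply: sumr_ge0 => z _; exact: mass_ge0.
have h1 := ler_wpM2r X0 kap_le_k.
have h2 := ler_wpM2l (ltW k_gt0) hsum.
have := mulr_gt0 L0 M0; have := hM; rewrite -/mu; lra.
Qed.

End Expand.

Lemma prob_expand j (S' : {set V}) (M : R) : inv j S' -> 0 < M ->
  (j = 0 -> forall v, v \in B -> deg v < 2 * M) ->
  256 * L * M <= \sum_(y | thinj j.+1 y) mass j.+1 y ->
  prob R E (fun w : choices V k => #|nbhd E (push_pull S' w) :\: S|%:R < M) <= fail_pr.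
Proof.
move=> hinv M0 hB.
have -> : \sum_(y | thinj j.+1 y) mass j.+1 y = \sum_(y in [set y | thinj j.+1 y]) mass j.+1 y.
  by apply: eq_bigl => y; rewrite inE.
move=> hM; pose mu := \sum_(y in [set y | thinj j.+1 y]) mass j.+1 y.
pose flux z := #|nb E z :&: [set y | thinj j.+1 y]|%:R * (kap * mass j z / deg z).
have split : mu = \sum_(z in [set z in [set z | livej j z] | 2 * M <= deg z]) flux z
               + \sum_(z in [set z in [set z | livej j z] | deg z < 2 * M]) flux z.
  rewrite /mu flow_out [LHS]big_mkcond [X in _ = X + _]big_mkcond [X in _ = _ + X]big_mkcond -big_split.
  apply: eq_bigr => z _; rewrite !inE; case: (livej j z) => /=; last by rewrite addr0.
  by case: ltP; rewrite ?add0r ?addr0.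
have [hlo|hlo] := leP (mu / 2) (\sum_(z in [set z in [set z | livej j z] | deg z < 2 * M]) flux z).
  exact: (expand_low hinv M0 hM hlo).
have [j0|j0] := posnP j; last first.
  apply: (expand_high hinv M0 hM j0); rewrite -/mu -/(flux _).
  by move: split hlo; lra.
(* At level 0 live nodes belong to [B], whose degrees are below [2 * M]. *)
exfalso; have hi0 : \sum_(z in [set z in [set z | livej j z] | 2 * M <= deg z]) flux z = 0.
  rewrite big1 // => z; rewrite !inE => /andP[/and3P[_ hz _] hd].
  case: (boolP (z \in B)) => [zB|zB]; first by have := hB j0 z zB; rewrite ltNge hd.
  by move: hz; rewrite j0 /= (negbTE zB) ler10.
have : 0 < 256 * L * M by rewrite !mulr_gt0 // (lt_le_trans ltr01).
by rewrite hi0 add0r in split; move: hM hlo; rewrite -/mu; lra.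
Qed.

Lemma prob_expand_after j (M : R) : 0 < M ->
  (forall v, j = 0 -> v \in B -> deg v < 2 * M) ->
  256 * L * M <= \sum_(y | thinj j.+1 y) mass j.+1 y ->
  prob_after R E k j.+1 S (fun S' => #|nbhd E S' :\: S|%:R < M) <= j.+1%:R * fail_pr.
Proof.
move=> M0 hB hM; rewrite -addn1.
have h1 : prob_after R E k j S (fun S' => ~~ inv j S') <= j%:R * fail_pr.
  apply: prob_after_chain inv0; first exact: fail_pr_ge0.
  by move=> i S2 _; exact: inv_step.
apply: (le_trans (prob_after_add j fail_pr_ge0 (G := inv j) _)); last first.
  by rewrite natrD mulrDl mul1r lerD2r.
by move=> S' _ hinv; rewrite prob_after1; exact: (prob_expand hinv M0 (fun j0 v => hB v j0) hM).
Qed.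

Lemma thin_mass_le j : \sum_(y | thin L (mass j) y) mass j y <= L * n.
Proof.
apply: (@le_trans _ _ (\sum_(y : V) L)); last by rewrite sumr_const mulr_natr.
rewrite big_mkcond; apply: ler_sum => y _; case: ifP => [/andP[_ /ltW]//|_].
by have := L1; lra.
Qed.

(* Either most of the walk mass is absorbed by nodes which get informed, and
   then reversing the walk most of [B] is informed after [J + J] rounds, or at
   some level a lot of mass is thinly spread, so that [S] has many neighbours
   after [j] rounds. *)
Lemma low_degree_dichotomy J :
  4 * n ^+ 2 < kap ^+ J.-1 -> 4 * J%:R * L <= k%:R ->
  (forall v, v \in B -> deg v < 2 * (kap / 2 * #|B|%:R / (2048 * L))) ->
  prob_after R E k (J + J) S (fun S' => (4 * #|B :&: S'| < #|B|)%N) <= (J + J)%:R * fail_pr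
  \/ exists2 j, (0 < j < J)%N &
     (kap / 2) ^+ j * #|B|%:R / (2048 * L) <= n /\
     prob_after R E k j S (fun S' =>
        #|nbhd E S' :\: S|%:R < (kap / 2) ^+ j * #|B|%:R / (2048 * L)) <= j%:R * fail_pr.
Proof.
move=> hJ JL hB; have L0 : 0 < L := lt_le_trans ltr01 L1.
have [h|h] := ltP (\sum_w mass 0 w * esc J J w) (#|B|%:R / 2); first by left; exact: prob_gain.
right; have [j jJ hj] := thin_level hJ h; exists j => //.
case: j jJ hj => // j jJ hj; set M := _ / (2048 * L).
have hM : 256 * L * M <= \sum_(y | thinj j.+1 y) mass j.+1 y.
  apply: le_trans hj; rewrite /M le_eqVlt; apply/orP; left; apply/eqP.
  by field; rewrite gt_eqF.
have kp : 0 < kap / 2 by rewrite divr_gt0 // kap_gt0.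
have M0 : 0 < M by rewrite divr_gt0 ?mulr_gt0 ?exprn_gt0 // ltr0n.
split.
  have := le_trans hM (thin_mass_le j.+1).
  have := mulr_gt0 L0 M0 => LM h2; rewrite -(ler_pM2l L0); lra.
apply: prob_expand_after => // v j0 vB; rewrite /M j0 expr1; exact: hB.
Qed.

End Flow.

(** * Growth of the informed set or of its boundary *)

Section Harmonic.
Variable R : realType.

Lemma harmonic_le (n : nat) : \sum_(i < n) (i.+1%:R)^-1 <= 1 + ln n%:R :> R.
Proof.
case: n => [|n]; first by rewrite big_ord0 ln0 ?addr0.
elim: n => [|n IH]; first by rewrite big_ord1 invr1 ln1 addr0.
rewrite big_ord_recr /=; apply: le_trans (lerD IH (lexx _)) _.
rewrite -addrA lerD2l -lerBrDl -opprB lerNr -ln_div ?posrE ?ltr0n //.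
have -> : n.+1%:R / n.+2%:R = 1 + - (n.+2%:R)^-1 :> R.
  have : 0 < n.+1%:R :> R by rewrite ltr0n.
  rewrite -[n.+2%:R]natr1; set x := n.+1%:R => x0; field; apply: lt0r_neq0; lra.
apply: le_ln1Dx; rewrite ltrN2 invf_lt1 ?ltr0n // ltr1n //.
Qed.

(** Averaging over the thresholds: [v] contributes [1 / d v] for each of the [d v] values
    [D <= d v], so the sums over all [D] add up to [#|B|]. If every sum were below
    [#|B| / ((2 + ln n) * D)], the harmonic sum would give less. *)
Lemma harmonic_class (T : finType) (B : {set T}) (d : T -> nat) (n : nat) :
  (forall v, v \in B -> (0 < d v <= n)%N) -> (0 < #|B|)%N ->
  exists2 D, (0 < D <= n)%N &
    #|B|%:R / (2 + ln n%:R) <= D%:R * \sum_(v in B | (D <= d v)%N) (d v)%:R^-1 :> R.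
Proof.
move=> dn B0.
have n0 : (0 < n)%N.
  by have /card_gt0P[v vB] := B0; have /andP[h1 h2] := dn v vB; exact: leq_trans h2.
have ln0 : 0 <= ln n%:R :> R by rewrite ln_ge0 // ler1n.
have H0 : 0 < 2 + ln n%:R :> R by lra.
have b0 : 0 < #|B|%:R :> R by rewrite ltr0n.
have [/existsP[i hi]|] := boolP [exists i : 'I_n, #|B|%:R / (2 + ln n%:R)
    <= i.+1%:R * \sum_(v in B | (i.+1 <= d v)%N) (d v)%:R^-1 :> R].
  by exists i.+1 => //; rewrite ltn_ord.
rewrite negb_exists => /forallP hno.
have e : #|B|%:R = \sum_(i < n) \sum_(v in B | (i.+1 <= d v)%N) (d v)%:R^-1 :> R.
  transitivity (\sum_(v in B) \sum_(i < n) (if (i < d v)%N then (d v)%:R^-1 else 0) : R).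
    rewrite -sum1_card natr_sum; apply: eq_bigr => v vB; have /andP[d0 dv] := dn v vB.
    rewrite -big_mkcond /= -(big_ord_widen n (fun=> (d v)%:R^-1) dv) sumr_const card_ord.
    by rewrite -[RHS]mulr_natr mulVf // pnatr_eq0 -lt0n.
  by rewrite exchange_big; apply: eq_bigr => i _; rewrite -big_mkcondr.
have : #|B|%:R <= \sum_(i < n) #|B|%:R / (2 + ln n%:R) * (i.+1%:R)^-1 :> R.
  rewrite {1}e; apply: ler_sum => i _; have := hno i; rewrite -ltNge => /ltW.
  by rewrite mulrC -ler_pdivlMr // ltr0n.
rewrite -mulr_sumr => h; have := le_trans h (ler_wpM2l _ (harmonic_le n)).
rewrite divr_ge0 ?(ltW b0) ?(ltW H0) // => /(_ isT).
rewrite mulrAC ler_pdivlMr // ler_pM2l //; lra.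
Qed.

End Harmonic.

(** * One subphase: the boundary is partly absorbed or enlarged *)

Section Subphase.
Variables (R : realType) (V : finType) (E : rel V) (k k' : nat) (L : R) (J : nat).
Hypothesis Esym : symmetric E.
Hypothesis L1 : 1 <= L.
Hypothesis k'0 : (0 < k')%N.
Hypothesis kk' : 8 * L * k'%:R <= k%:R.
Local Notation n := (#|V|%:R : R).
Local Notation kap := (kap R k').
Local Notation fail_pr := (fail_pr V L).
Hypothesis hJ : 4 * n ^+ 2 < kap ^+ J.-1.
Hypothesis JL : 4 * J%:R * L <= k%:R.
Hypothesis Lln : 2 * L * (2 + ln n) <= k%:R.
Hypothesis J0 : (0 < J)%N.

(** Growth factor of the boundary: [kap / 2] divided by the [2048 * L] of [low_degree_dichotomy] and
    by 4, since the low part may be only a quarter of the boundary. *)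
Definition rho : R := kap / (16384 * L).
Local Notation deg v := (#|nb E v|%:R : R).

Let L0 : 0 < L := lt_le_trans ltr01 L1.

Lemma prob_after_mono t1 t2 (S : {set V}) (Q : pred {set V}) : (t1 <= t2)%N ->
  (forall A B : {set V}, A \subset B -> Q B -> Q A) ->
  prob_after R E k t2 S Q <= prob_after R E k t1 S Q.
Proof.
move=> t12 Qmono; rewrite -(subnKC t12).
apply: le_trans (@prob_after_add R V E k t1 (t2 - t1) S (fun A => ~~ Q A) Q 0 _ _) _ => //.
  move=> S' _ nQ; rewrite prob_after_pred0 // => S2 h; apply: contra nQ; exact: Qmono.
by rewrite addr0; apply: le_prob_after => S' _; rewrite negbK.
Qed.

Section FromS.
Variable S : {set V}.
Local Notation b := (#|boundary E S|).
Hypothesis b0 : (0 < b)%N.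
Local Notation maj := (majority E S).
Local Notation new_nbhd S' := (#|nbhd E S' :\: S|%:R : R).

Definition high_boundary : {set V} :=
  [set v in boundary E S :\: maj | 2 * (rho * b%:R) <= deg v].

Lemma high_boundary_win (S' : {set V}) z (M : R) : z \in S' -> z \notin maj ->
  2 * M <= deg z -> M <= new_nbhd S'.
Proof.
move=> zS zm hz; have := notin_majority R zm => h.
apply: (@le_trans _ _ (#|nb E z :\: S|%:R)); first lra.
by rewrite ler_nat subset_leq_card // setSD // nb_sub_nbhd.
Qed.

Lemma high_boundary_nb v : v \in high_boundary ->
  [/\ v \notin maj, (0 < #|S :&: nb E v|)%N & 2 * (rho * b%:R) <= deg v].
Proof.
rewrite inE => /andP[]; rewrite in_setD => /andP[vm vb] h; split => //.
move: vb; rewrite in_setD => /andP[_ /nbhdP[u uS uv]].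
by apply/card_gt0P; exists u; rewrite in_setI uS nbC.
Qed.

Lemma rho_gt0 : 0 < rho.
Proof. by apply: divr_gt0; [exact: kap_gt0|exact: mulr_gt0]. Qed.

(** At least a quarter of the boundary lies in [majority] and is pulled in one round, or a quarter
    consists of nodes of low degree and the dichotomy applies to it, or half of it has high degree.
    The 16 is the quarter chosen times the quarter of it that gets informed. *)
Lemma subphase :
  [\/ prob_after R E k (J + J) S (fun S' => (16 * #|S' :\: S| < b)%N) <= (J + J)%:R * fail_pr,
      exists2 j, (0 < j < J)%N & exists2 M, rho ^+ j * b%:R <= M <= n &
        prob_after R E k j S (fun S' => new_nbhd S' < M) <= j%:R * fail_pr
    | (b <= 2 * #|high_boundary|)%N].
Proof.
have bigB (A : {set V}) : A \subset boundary E S -> (b <= 4 * #|A|)%N ->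
    forall S', (16 * #|S' :\: S| < b)%N -> (4 * #|A :&: S'| < #|A|)%N.
  move=> /subsetP AB hA S' hS'; suff : (#|A :&: S'| <= #|S' :\: S|)%N by lia.
  apply: subset_leq_card; apply/subsetP => v; rewrite !in_setI in_setD => /andP[vA ->].
  by rewrite andbT; have := AB v vA; rewrite in_setD => /andP[].
have [hm|hm] := leqP b (4 * #|boundary E S :&: maj|).
  constructor 1; apply: (@le_trans _ _ fail_pr); last first.
    by rewrite ler_peMl ?fail_pr_ge0 // ler1n; lia.
  apply: (@le_trans _ _ (prob_after R E k 1 S (fun S' => (16 * #|S' :\: S| < b)%N))).
    apply: prob_after_mono; first by lia.
    move=> A B AB h; apply: leq_ltn_trans h.
    by rewrite leq_mul2l subset_leq_card // setSD.
  rewrite prob_after1; apply: le_trans (le_trans (prob_saturated E k S (ltW L0)) (saturated_fail_pr V L1)).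
  apply: le_prob => w; apply: contraTN => hsat; rewrite -leqNgt.
  have hsub : maj \subset push_pull S w.
    apply: subset_trans (majority_saturated E L1 k'0 kk' (subxx S)) _.
    by rewrite subUset hsat sub_push_pull.
  apply: leq_trans hm _; apply: (@leq_trans (4 * #|push_pull S w :\: S|)); last by lia.
  rewrite leq_mul2l /=; apply: subset_leq_card; apply/subsetP => v.
  by rewrite in_setI !in_setD => /andP[/andP[-> _] /(subsetP hsub)].
have hsplit := cardsID maj (boundary E S).
set low := [set v in boundary E S :\: maj | deg v < 2 * (rho * b%:R)].
have hsplit2 : (#|boundary E S :\: maj| = #|low| + #|high_boundary|)%N.
  rewrite -(cardsID low); congr (_ + _)%N; apply: eq_card => v; rewrite !inE.
    by case: (deg v < _); rewrite ?andbT ?andbF ?andbb.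
  by rewrite leNgt; case: (deg v < _); rewrite ?andbT ?andbF ?andbb // ?andNb // => //; case: (~~ _ && _).
have [hl|hl] := leqP b (4 * #|low|); last by constructor 3; lia.
have lowb : low \subset boundary E S.
  by apply/subsetP => v; rewrite inE in_setD => /andP[/andP[]].
have low0 : (0 < #|low|)%N by lia.
have lowN : low \subset nbhd E S by apply: subset_trans lowb (subsetDl _ _).
have hbl : b%:R <= 4 * #|low|%:R :> R by rewrite -natrM ler_nat.
have kp := kap_gt0 R k'0.
have hdeg v : v \in low -> deg v < 2 * (kap / 2 * #|low|%:R / (2048 * L)).
  rewrite inE => /andP[_ h]; apply: (lt_le_trans h); rewrite ler_pM2l // /rho.
  have -> : kap / 2 * #|low|%:R / (2048 * L) = kap / (16384 * L) * (4 * #|low|%:R).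
    by field; rewrite gt_eqF.
  by rewrite ler_pM2l // divr_gt0 // mulr_gt0.
case: (low_degree_dichotomy Esym L1 k'0 kk' lowN low0 hJ JL hdeg) => [h|[j jJ [hMn hM]]].
  constructor 1; apply: le_trans h; apply: le_prob_after => S' _.
  exact: (bigB low).
constructor 2; exists j => //; exists ((kap / 2) ^+ j * #|low|%:R / (2048 * L)) => //.
rewrite hMn andbT; case: j jJ {hMn hM} => // j _.
have hr : rho ^+ j <= (kap / 2) ^+ j.
  rewrite lerXn2r ?nnegrE ?(ltW rho_gt0) ?divr_ge0 ?(ltW kp) // /rho ler_pM2l //.
  by rewrite lef_pV2 ?posrE ?mulr_gt0 //; have := L1; lra.
(* The level is positive, so one factor [rho] pays for all constants. *)
rewrite !exprS; have r0 : 0 <= rho ^+ j by rewrite exprn_ge0 // ltW // rho_gt0.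
have -> : kap / 2 * (kap / 2) ^+ j * #|low|%:R / (2048 * L) = (kap / 2) ^+ j * (rho * (4 * #|low|%:R)).
  by rewrite /rho; field; rewrite gt_eqF.
rewrite -mulrA [rho * _]mulrCA; apply: ler_pM => //; first by rewrite mulr_ge0 // ltW // rho_gt0.
by rewrite ler_pM2l // rho_gt0.
Qed.

(** Nodes of [S] have degree at most [#|S| + b <= 2 * b], and at least [b / 2] edges lead to
    [high_boundary], so the expected number of pushes into it is at least [k / 4 >= 2 * L]. *)
Lemma high_small : (#|S| <= b)%N -> (b <= 2 * #|high_boundary|)%N ->
  prob_after R E k 1 S (fun S' => new_nbhd S' < rho * b%:R) <= fail_pr.
Proof.
move=> Sb hb; rewrite prob_after1.
apply: (@le_trans _ _ (prob R E (fun w : choices V k => [disjoint high_boundary & push_pull S w]))).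
  apply: le_prob => w; apply: contraTT => /pred0Pn[z /= /andP[/high_boundary_nb[zm _ hz] zS]].
  by rewrite -leNgt; exact: high_boundary_win hz.
apply: le_trans (prob_no_push _ E k high_boundary (subxx S)) _.
apply: le_trans (saturated_fail_pr V L1); apply: (@le_trans _ _ (expR (- L))); last first.
  rewrite ler_peMl ?expR_ge0 // ler1n; apply: leq_trans b0 _; exact: max_card.
rewrite ler_expR lerN2.
have b0R : 0 < 2 * b%:R :> R by rewrite mulr_gt0 // ltr0n.
have h1 : #|high_boundary|%:R / (2 * b%:R) <= \sum_(u in S) #|high_boundary :&: nb E u|%:R / deg u.
  apply: (@le_trans _ _ (\sum_(u in S) #|high_boundary :&: nb E u|%:R / (2 * b%:R))).
    rewrite -mulr_suml ler_wpM2r ?invr_ge0 ?(ltW b0R) //.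
    have -> : \sum_(u in S) #|high_boundary :&: nb E u|%:R
        = \sum_(v in high_boundary) #|S :&: nb E v|%:R :> R.
      transitivity (\sum_(u in S) \sum_(v in high_boundary) (v \in nb E u)%:R : R).
        apply: eq_bigr => u _; rewrite -sum1_card natr_sum big_mkcond [RHS]big_mkcond.
        by apply: eq_bigr => v _; rewrite in_setI; case: (v \in high_boundary); case: (_ \in nb _ _).
      rewrite exchange_big; apply: eq_bigr => v _.
      rewrite -sum1_card natr_sum big_mkcond [RHS]big_mkcond; apply: eq_bigr => u _.
      by rewrite in_setI nbC //; case: (u \in S); case: (_ \in nb _ _).
    rewrite -sum1_card natr_sum; apply: ler_sum => v /high_boundary_nb[_ h _].
    by rewrite ler1n.
  apply: ler_sum => u uS.
  have [d0|d0] := posnP #|nb E u|.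
    have -> : #|high_boundary :&: nb E u| = 0%N.
      by apply/eqP; rewrite -leqn0 -d0 subset_leq_card // subsetIr.
    by rewrite !mul0r.
  rewrite ler_wpM2l // lef_pV2 ?posrE ?ltr0n // -natrM ler_nat.
  have : (#|nb E u| <= #|S :|: boundary E S|)%N.
    rewrite subset_leq_card //; apply: subset_trans (nb_sub_nbhd E uS) _.
    by rewrite /boundary; apply/subsetP => v vn; rewrite in_setU in_setD vn; case: (v \in S).
  by have [h _] := leq_card_setU S (boundary E S); move: h Sb; clear; lia.
have h2 : 4^-1 <= #|high_boundary|%:R / (2 * b%:R) :> R.
  rewrite ler_pdivlMr //; have : b%:R <= 2 * #|high_boundary|%:R :> R by rewrite -natrM ler_nat.
  lra.
have := ler_wpM2l (ltW (k_gt0 L1 k'0 kk')) (le_trans h2 h1).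
have := L8k L1 k'0 kk'; have := L0; lra.
Qed.

(** Here pulls do the work. [harmonic_class] yields a degree threshold [D] such that about [D / b]
    rounds suffice for some node of degree at least [D] to pull the rumor. It brings [D / 2] new
    neighbours, so the time is proportional to the gain. *)
Lemma high_large : (b <= 2 * #|high_boundary|)%N ->
  exists tau M, [/\ (0 < tau)%N, tau%:R <= 1 + 2 * M / b%:R, rho * b%:R <= M <= n
    & prob_after R E k tau S (fun S' => new_nbhd S' < M) <= fail_pr].
Proof.
move=> hb; have hb0 : (0 < #|high_boundary|)%N.
  by have := leq_trans b0 hb; rewrite muln_gt0.
have b0R : 0 < b%:R :> R by rewrite ltr0n.
have dn v : v \in high_boundary -> (0 < #|nb E v| <= #|V|)%N.
  move=> /high_boundary_nb[_ h _]; rewrite max_card andbT.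
  by apply: leq_trans h _; rewrite subset_leq_card // subsetIr.
have [D /andP[D0 Dn] hD] := harmonic_class R dn hb0.
set W := [set v in high_boundary | (D <= #|nb E v|)%N].
set sg := \sum_(v in high_boundary | _) _ in hD.
have D0R : 0 < D%:R :> R by rewrite ltr0n.
have n1 : 1 <= n by rewrite ler1n; apply: leq_trans hb0 (max_card _).
have H0 : 0 < 2 + ln n by have := ln_ge0 n1; lra.
have hsg : #|high_boundary|%:R <= (2 + ln n) * (D%:R * sg).
  by rewrite mulrC -ler_pdivrMr.
have hb2 : b%:R <= 2 * #|high_boundary|%:R :> R by rewrite -natrM ler_nat.
have sg0 : 0 < sg.
  have : 0 < (2 + ln n) * (D%:R * sg) by apply: lt_le_trans hsg; rewrite ltr0n.
  by rewrite pmulr_rgt0 // pmulr_rgt0.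
have W0 : exists2 v, v \in high_boundary & (D <= #|nb E v|)%N.
  have [/existsP[v /andP[v1 v2]]|] := boolP [exists v, (v \in high_boundary) && (D <= #|nb E v|)%N].
    by exists v.
  rewrite negb_exists => /forallP h; move: sg0; rewrite /sg big1 ?ltxx // => v hv.
  by have := h v; rewrite hv.
(* Nodes of [W] satisfy both degree bounds, so either one may be claimed. *)
set M := Num.max (D%:R / 2) (rho * b%:R).
have hM2 : D%:R / 2 <= M by rewrite le_max lexx.
have hMD : D%:R <= 2 * M by lra.
set q := Num.truncn (D%:R / b%:R : R).
exists q.+1, M; split => //.
- have /andP[h _] := truncn_itv (divr_ge0 (ltW D0R) (ltW b0R)); rewrite -/q in h.
  rewrite -natr1 addrC lerD2l; apply: le_trans h _; rewrite ler_wpM2r // invr_ge0; exact: ltW.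
- rewrite le_max lexx orbT /=; rewrite ge_max; apply/andP; split.
    by have : D%:R <= n; [rewrite ler_nat | lra].
  have [v /high_boundary_nb[_ _ hv] _] := W0.
  have : deg v <= n by rewrite ler_nat max_card.
  lra.
apply: (@le_trans _ _ (expR (- (k%:R * sg)) ^+ q.+1)); last first.
  apply: le_trans (saturated_fail_pr V L1).
  apply: (@le_trans _ _ (expR (- L))); last by rewrite ler_peMl ?expR_ge0.
  rewrite -expRM_natl ler_expR mulrN lerN2.
  have /andP[_ /ltW h] := truncn_itv (divr_ge0 (ltW D0R) (ltW b0R)); rewrite -/q in h.
  have ks0 : 0 < k%:R * sg by rewrite mulr_gt0 // (k_gt0 L1 k'0 kk').
  apply: le_trans (ler_wpM2r (ltW ks0) h).
  have e : D%:R / b%:R * (k%:R * sg) = k%:R * (D%:R * sg) / b%:R by ring.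
  rewrite e ler_pdivlMr //.
  have Ds0 : 0 <= D%:R * sg by rewrite mulr_ge0 // ltW.
  have := ler_wpM2r Ds0 Lln; have := ler_wpM2l (ltW L0) hb2; have := ler_wpM2l (ltW L0) hsg; lra.
apply: (@le_trans _ _ (prob_after R E k q.+1 S (fun S' => [disjoint W & S']))).
  apply: le_prob_after => S' _; apply: contraTT => /pred0Pn[z /= /andP[]].
  rewrite inE => /andP[/high_boundary_nb[zm _ hz] hz2] zS; rewrite -leNgt.
  have hD2 : D%:R <= deg z by rewrite ler_nat.
  have hM : M <= deg z / 2 by rewrite ge_max; apply/andP; split; lra.
  by apply: high_boundary_win zS zm _; lra.
apply: prob_after_stay; first exact: expR_ge0.
  move=> A B AB; rewrite !disjoints_subset => WB; apply: subset_trans WB _.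
  by rewrite setCS.
move=> S' SS' _; apply: le_trans (prob_no_pull _ E k S' W) _.
rewrite ler_expR lerN2 ler_wpM2l //.
rewrite /sg; have -> : \sum_(v in high_boundary | (D <= #|nb E v|)%N) (deg v)^-1 = \sum_(v in W) (deg v)^-1.
  by apply: eq_bigl => v; rewrite [RHS]inE.
apply: ler_sum => v; rewrite inE => /andP[/high_boundary_nb[_ h _] _].
rewrite ler_peMl ?invr_ge0 // ler1n; apply: leq_trans h _.
by rewrite subset_leq_card // setSI.
Qed.

End FromS.
End Subphase.

(** * Potentials *)

Section Regimes.
Variables (R : realType) (V : finType) (E : rel V) (k k' : nat) (L : R) (J : nat).
Hypothesis Esym : symmetric E.
Hypothesis L1 : 1 <= L.
Hypothesis k'0 : (0 < k')%N.
Hypothesis kk' : 8 * L * k'%:R <= k%:R.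
Local Notation n := (#|V|%:R : R).
Hypothesis hJ : 4 * n ^+ 2 < kap R k' ^+ J.-1.
Hypothesis JL : 4 * J%:R * L <= k%:R.
Hypothesis Lln : 2 * L * (2 + ln n) <= k%:R.
Hypothesis J0 : (0 < J)%N.
Local Notation rho := (rho k' L).
Hypothesis rho4 : 4 <= rho.
Local Notation T := ((J + J)%:R : R).
Local Notation bd S := (#|boundary E S|%:R : R).

Definition phase_fail : R := T * fail_pr V L.

Lemma phase_fail_ge0 : 0 <= phase_fail.
Proof. by rewrite mulr_ge0 // fail_pr_ge0. Qed.

Lemma le_phase_fail (j : nat) : (j <= J + J)%N -> j%:R * fail_pr V L <= phase_fail.
Proof. by move=> h; rewrite ler_wpM2r ?fail_pr_ge0 // ler_nat. Qed.

Lemma card_growth (S S' : {set V}) : S \subset S' ->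
  #|S'|%:R = #|S|%:R + #|S' :\: S|%:R :> R.
Proof. by move=> SS'; rewrite -(cardsID S S') (setIidPr SS') natrD. Qed.

Lemma boundary_growth (S S' : {set V}) : S \subset S' ->
  #|nbhd E S' :\: S|%:R - #|S' :\: S|%:R <= bd S'.
Proof.
move=> SS'; rewrite lerBlDr -natrD ler_nat.
apply: leq_trans (leq_card_setU _ _).1; apply: subset_leq_card; apply/subsetP => v.
rewrite in_setU !in_setD => /andP[-> ->]; by case: (v \in S').
Qed.

(** * Multiplicative growth up to [m] nodes *)

Section Multiplicative.
Variables (phi m : R).
Hypothesis phi1 : 1 < phi.
Hypothesis hphi : forall S : {set V}, (0 < #|S|)%N -> #|S|%:R <= m -> phi * #|S|%:R <= bd S.

(** Bound on the rounds still needed. A growth of [S] by the factor [1 + phi / 16] pays for [T]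
    rounds and for a complete collapse of the boundary; between such events every round multiplies
    the boundary by [rho / 2]. The summand 1 keeps the potential above [T]. *)
Definition theta_mul (S : {set V}) : R :=
  (T + ln n / ln (rho / 2)) * ((ln n - ln #|S|%:R) / ln (1 + phi / 16) + 1)
  + (ln n - ln (bd S)) / ln (rho / 2).

Let l1 : 0 < ln (1 + phi / 16).
Proof. by rewrite ln_gt0 //; have := phi1; lra. Qed.

Let l2 : 0 < ln (rho / 2).
Proof. by rewrite ln_gt0 //; have := rho4; lra. Qed.

(** With the convention that [ln 0] is 0 this covers empty boundaries. *)
Lemma ln_card_ge0 (S : {set V}) : 0 <= ln #|S|%:R :> R.
Proof.
have [->|h] := posnP #|S|; first by rewrite ln0.
by rewrite ln_ge0 // ler1n.
Qed.

Lemma ln_card_le (S : {set V}) : ln #|S|%:R <= ln n.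
Proof.
have [h|h] := posnP #|S|.
  by rewrite h ln0 // -cardsT ln_card_ge0.
by rewrite ler_ln ?posrE ?ltr0n // ?ler_nat ?max_card //; apply: leq_trans h (max_card _).
Qed.

Lemma theta_mul_gain (S S' : {set V}) : (0 < #|S|)%N -> #|S|%:R <= m -> S \subset S' ->
  bd S <= 16 * #|S' :\: S|%:R -> theta_mul S' + T <= theta_mul S.
Proof.
move=> S0 Sm SS' h; have S0R : 0 < #|S|%:R :> R by rewrite ltr0n.
have hb := hphi S0 Sm.
have hln : ln #|S|%:R + ln (1 + phi / 16) <= ln #|S'|%:R :> R.
  have p0 : 0 < 1 + phi / 16 by have := phi1; lra.
  have g0 := ler0n R #|S' :\: S|.
  have S'0 : 0 < #|S'|%:R :> R by rewrite (card_growth SS') ltr_wpDr.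
  rewrite -lnM ?posrE // ler_ln ?posrE ?mulr_gt0 // (card_growth SS'); lra.
have h1 := ln_card_le (boundary E S); have h2 := ln_card_ge0 (boundary E S').
have ln_n0 : 0 <= ln n by rewrite -cardsT ln_card_ge0.
have A0 : 0 <= T + ln n / ln (rho / 2) by rewrite addr_ge0 // divr_ge0 // ltW.
have h3 : (ln n - ln #|S'|%:R) / ln (1 + phi / 16) + 1 <= (ln n - ln #|S|%:R) / ln (1 + phi / 16).
  rewrite -(ler_pM2r l1) mulrDl mul1r !divfK ?gt_eqF //; lra.
have h4 := ler_wpM2l A0 h3.
have h5 : (ln n - ln (bd S')) / ln (rho / 2) <= ln n / ln (rho / 2).
  by rewrite ler_wpM2r ?invr_ge0 ?(ltW l2) //; lra.
have h6 : 0 <= (ln n - ln (bd S)) / ln (rho / 2).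
  by rewrite divr_ge0 ?(ltW l2) // subr_ge0.
rewrite /theta_mul; lra.
Qed.

Lemma theta_mul_expand (S S' : {set V}) (j : nat) : (0 < #|S|)%N -> #|S|%:R <= m ->
  S \subset S' -> (0 < j <= J + J)%N ->
  rho ^+ j * bd S <= #|nbhd E S' :\: S|%:R -> theta_mul S' + j%:R <= theta_mul S.
Proof.
move=> S0 Sm SS' /andP[j0 jT] h; have S0R : 0 < #|S|%:R :> R by rewrite ltr0n.
have [hg|hg] := leP (bd S) (16 * #|S' :\: S|%:R).
  by apply: le_trans (theta_mul_gain S0 Sm SS' hg); rewrite lerD2l ler_nat.
have hb := hphi S0 Sm.
have b0 : 0 < bd S by apply: lt_le_trans hb; rewrite mulr_gt0 // (lt_trans ltr01).
(* The 1 makes up for the nodes informed meanwhile, fewer than [bd S / 16]. *)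
have hr : (rho / 2) ^+ j + 1 <= rho ^+ j.
  case: j j0 {jT h} => // j _; rewrite !exprS exprMn.
  have r1 : 1 <= rho ^+ j by rewrite exprn_ege1 //; have := rho4; lra.
  have h1 : 2^-1 ^+ j <= 1 :> R by rewrite exprn_ile1 //; lra.
  have h0 : 0 <= 2^-1 ^+ j :> R by rewrite exprn_ge0 // invr_ge0.
  have h2 : rho ^+ j * 2^-1 ^+ j <= rho ^+ j by rewrite ler_piMr //; lra.
  have := rho4; nra.
have hbS : (rho / 2) ^+ j * bd S <= bd S'.
  apply: le_trans (boundary_growth SS'); have := ler_wpM2r (ltW b0) hr; lra.
have hln : ln (bd S) + j%:R * ln (rho / 2) <= ln (bd S').
  have r0 : 0 < rho / 2 by have := rho4; lra.
  rewrite mulr_natl -lnXn // addrC -lnM ?posrE ?exprn_gt0 //.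
  by rewrite ler_ln ?posrE ?mulr_gt0 ?exprn_gt0 // (lt_le_trans _ hbS) // mulr_gt0 ?exprn_gt0.
have hlnS : ln #|S|%:R <= ln #|S'|%:R :> R.
  rewrite ler_ln ?posrE ?ltr0n ?ler_nat ?subset_leq_card //.
  by apply: leq_trans S0 _; exact: subset_leq_card.
have ln_n0 : 0 <= ln n by rewrite -cardsT ln_card_ge0.
have A0 : 0 <= T + ln n / ln (rho / 2) by rewrite addr_ge0 // divr_ge0 // ltW.
have h3 : (ln n - ln #|S'|%:R) / ln (1 + phi / 16) + 1 <= (ln n - ln #|S|%:R) / ln (1 + phi / 16) + 1.
  by rewrite lerD2r ler_wpM2r ?invr_ge0 ?(ltW l1) //; lra.
have h4 := ler_wpM2l A0 h3.
have h5 : (ln n - ln (bd S')) / ln (rho / 2) + j%:R <= (ln n - ln (bd S)) / ln (rho / 2).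
  rewrite -(ler_pM2r l2) mulrDl !divfK ?gt_eqF //; lra.
rewrite /theta_mul; lra.
Qed.

Lemma theta_mul_ge (S : {set V}) : T <= theta_mul S.
Proof.
have h1 := ln_card_le (boundary E S); have h2 := ln_card_le S.
have ln_n0 : 0 <= ln n by rewrite -cardsT ln_card_ge0.
have A0 : T <= T + ln n / ln (rho / 2) by rewrite lerDl divr_ge0 // ltW.
have T0 : 0 <= T by [].
have q1 : 0 <= (ln n - ln #|S|%:R) / ln (1 + phi / 16) by rewrite divr_ge0 ?subr_ge0 // ltW.
have q2 : 0 <= (ln n - ln (bd S)) / ln (rho / 2) by rewrite divr_ge0 ?subr_ge0 // ltW.
rewrite /theta_mul; have := mulr_ge0 (le_trans T0 A0) q1; lra.
Qed.

Lemma theta_mul_le (S : {set V}) :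
  theta_mul S <= (T + ln n / ln (rho / 2)) * (ln n / ln (1 + phi / 16) + 1) + ln n / ln (rho / 2).
Proof.
have ln_n0 : 0 <= ln n by rewrite -cardsT ln_card_ge0.
have A0 : 0 <= T + ln n / ln (rho / 2) by rewrite addr_ge0 // divr_ge0 // ltW.
apply: lerD.
  by rewrite ler_wpM2l // lerD2r ler_wpM2r ?invr_ge0 ?(ltW l1) // gerBl ln_card_ge0.
by rewrite ler_wpM2r ?invr_ge0 ?(ltW l2) // gerBl ln_card_ge0.
Qed.

Lemma reach_mul (N : nat) (S : {set V}) : (0 < #|S|)%N -> theta_mul S <= N%:R ->
  prob_after R E k N S (fun S' => ~~ (m < #|S'|%:R)) <= N.+1%:R * phase_fail.
Proof.
move=> S0 hN.
apply: (prob_after_descent (P := fun S : {set V} => (0 < #|S|)%N) phase_fail_ge0 _ _ _ S0 hN).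
- by move=> A B AB A0; apply: leq_trans A0 _; exact: subset_leq_card.
- by move=> A B AB; move=> /lt_le_trans; apply; rewrite ler_nat subset_leq_card.
move=> {S0 hN}S S0; rewrite -leNgt => Sm.
have hb := hphi S0 Sm.
have S0R : 0 < #|S|%:R :> R by rewrite ltr0n.
(* The condition of [high_small] comes from [1 < phi]. *)
have Sb : (#|S| <= #|boundary E S|)%N by rewrite -(ler_nat R); apply: le_trans hb; rewrite ler_peMl ?(ltW phi1) // ltW.
have b0 : (0 < #|boundary E S|)%N by apply: leq_trans S0 Sb.
have expand (j : nat) (M : R) : (0 < j <= J + J)%N -> rho ^+ j * bd S <= M ->
    prob_after R E k j S (fun S' => #|nbhd E S' :\: S|%:R < M) <= j%:R * fail_pr V L ->
    exists2 tau : nat, (0 < tau)%N & tau%:R <= theta_mul S /\ prob_after R E k tau S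
      (fun S' => ~~ ((m < #|S'|%:R) || (theta_mul S' + tau%:R <= theta_mul S))) <= phase_fail.
  move=> jT hM hp; have /andP[j0 jT'] := jT; exists j => //; split.
    by apply: le_trans (theta_mul_ge S); rewrite ler_nat.
  apply: le_trans (le_phase_fail jT'); apply: le_trans hp; apply: le_prob_after => S' SS'.
  rewrite negb_or => /andP[_]; apply: contraNT; rewrite -leNgt => h.
  by apply: theta_mul_expand => //; exact: le_trans h.
case: (subphase Esym L1 k'0 kk' hJ JL Lln J0 b0) => [h|[j /andP[j0 jJ] [M /andP[hM _] h]]|h].
- exists (J + J)%N; first by rewrite addn_gt0 J0.
  split; first exact: theta_mul_ge.
  apply: le_trans h; apply: le_prob_after => S' SS'.
  rewrite negb_or => /andP[_]; apply: contraNT; rewrite -leqNgt => h.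
  by apply: theta_mul_gain => //; rewrite -natrM ler_nat.
- by apply: (expand j M) => //; rewrite j0 /=; apply: leq_trans (ltnW jJ) (leq_addr _ _).
- apply: (expand 1%N (rho * bd S)); rewrite ?expr1 ?addn_gt0 ?J0 //.
  by rewrite mul1r; exact: (high_small Esym L1 k'0 kk' b0 Sb h).
Qed.

End Multiplicative.

(** * Additive growth up to half of the nodes *)

Section Additive.
Variables (m beta : R).
Hypothesis beta1 : 1 <= beta.
Hypothesis hbeta : forall S : {set V}, m < #|S|%:R -> (2 * #|S| <= #|V|)%N -> beta <= bd S.

(** Informing [bd S / 16] nodes lowers the first term by [(T + 6) * bd S], of which 6 pays for a
    collapse of the boundary. An expansion to [M >= 4 * bd S] lowers the numerator by at least
    [6 * M - 6 * bd S], which covers [bd S + 2 * M]. *)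
Definition theta_add (S : {set V}) : R :=
  (16 * (T + 6) * (n - #|S|%:R) + 6 * (n - bd S)) / beta.

Let beta0 : 0 < beta := lt_le_trans ltr01 beta1.

Lemma card_le_n (S : {set V}) : #|S|%:R <= n.
Proof. by rewrite ler_nat max_card. Qed.

Lemma theta_add_gain (S S' : {set V}) : beta <= bd S -> S \subset S' ->
  bd S <= 16 * #|S' :\: S|%:R -> theta_add S' + T <= theta_add S.
Proof.
move=> hb SS' h; rewrite -lerBrDl /theta_add -mulrBl ler_pdivlMr // (card_growth SS').
have T0 : 0 <= T by [].
have := ler0n R #|boundary E S'|.
have T6 : 0 <= T + 6 by lra.
have h1 := ler_wpM2l T6 h; have h2 := ler_wpM2l T0 hb; lra.
Qed.

Lemma theta_add_expand (S S' : {set V}) (M tau : R) : beta <= bd S -> S \subset S' ->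
  rho * bd S <= M -> tau <= 1 + 2 * M / bd S ->
  M <= #|nbhd E S' :\: S|%:R -> theta_add S' + tau <= theta_add S.
Proof.
move=> hb SS' hM htau h; rewrite -lerBrDl /theta_add -mulrBl ler_pdivlMr // (card_growth SS').
have T0 : 0 <= T by [].
have b0 : 0 < bd S := lt_le_trans beta0 hb.
have hMb : 4 * bd S <= M by apply: le_trans hM; rewrite ler_wpM2r // ltW.
have h1 := boundary_growth SS'.
have h2 : tau * beta <= bd S + 2 * M.
  apply: (@le_trans _ _ ((1 + 2 * M / bd S) * beta)); first by rewrite ler_wpM2r // ltW.
  apply: (@le_trans _ _ ((1 + 2 * M / bd S) * bd S)).
    by rewrite ler_wpM2l // addr_ge0 // divr_ge0 ?(ltW b0) //; lra.
  by rewrite mulrDl mul1r divfK // gt_eqF.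
have g0 := ler0n R #|S' :\: S|; have h3 := mulr_ge0 T0 g0; lra.
Qed.

Lemma theta_add_ge (S : {set V}) (M : R) : beta <= bd S -> (2 * #|S| <= #|V|)%N ->
  0 <= M <= n -> T <= theta_add S /\ 1 + 2 * M / bd S <= theta_add S.
Proof.
move=> hb hS /andP[M0 Mn]; have bn := card_le_n (boundary E S).
have hS' : 2 * #|S|%:R <= n by rewrite -natrM ler_nat.
have b0 : 0 < bd S := lt_le_trans beta0 hb.
have T0 : 0 <= T by [].
have h : 8 * (T + 6) * n <= 16 * (T + 6) * (n - #|S|%:R) + 6 * (n - bd S).
  have T6 : 0 <= T + 6 by lra.
  have := ler_wpM2l T6 hS'; lra.
have n0 : 0 <= n by [].
have Tn := mulr_ge0 T0 n0.
split; rewrite ler_pdivlMr //; apply: le_trans h.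
  have := ler_wpM2l T0 (le_trans hb bn); lra.
apply: (@le_trans _ _ ((1 + 2 * M / bd S) * bd S)).
  by rewrite ler_wpM2l // addr_ge0 // divr_ge0 ?(ltW b0) //; lra.
rewrite mulrDl mul1r divfK ?gt_eqF //; lra.
Qed.

Lemma theta_add_le (S : {set V}) : theta_add S <= (16 * T + 102) * n / beta.
Proof.
rewrite ler_wpM2r ?invr_ge0 ?(ltW beta0) //.
have T0 : 0 <= T by [].
have := mulr_ge0 T0 (ler0n R #|S|); have := ler0n R #|S|; have := ler0n R #|boundary E S|; lra.
Qed.

Lemma reach_add (N : nat) (S : {set V}) : m < #|S|%:R -> theta_add S <= N%:R ->
  prob_after R E k N S (fun S' => ~~ (#|V| < 2 * #|S'|)%N) <= N.+1%:R * phase_fail.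
Proof.
move=> S0 hN.
apply: (prob_after_descent (P := fun S : {set V} => m < #|S|%:R) phase_fail_ge0 _ _ _ S0 hN).
- by move=> A B AB /lt_le_trans; apply; rewrite ler_nat subset_leq_card.
- by move=> A B AB h; apply: leq_trans h _; rewrite leq_mul2l subset_leq_card.
move=> {S0 hN}S Sm; rewrite -leqNgt => S2.
have hb := hbeta Sm S2.
have b0R : 0 < bd S := lt_le_trans beta0 hb.
have b0 : (0 < #|boundary E S|)%N by rewrite -(ltr_nat R).
have T1 : (0 < J + J)%N by rewrite addn_gt0 J0.
have expand (j : nat) (M : R) : (0 < j)%N -> j%:R <= 1 + 2 * M / bd S -> rho * bd S <= M <= n ->
    prob_after R E k j S (fun S' => #|nbhd E S' :\: S|%:R < M) <= phase_fail ->
    exists2 tau : nat, (0 < tau)%N & tau%:R <= theta_add S /\ prob_after R E k tau S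
      (fun S' => ~~ ((#|V| < 2 * #|S'|)%N || (theta_add S' + tau%:R <= theta_add S))) <= phase_fail.
  move=> j0 jM /andP[hM Mn] hp; exists j => //; split.
    apply: le_trans jM _; apply: (theta_add_ge hb S2 _).2.
    by rewrite Mn andbT; apply: le_trans hM; rewrite mulr_ge0 //; have := rho4; lra.
  apply: le_trans hp; apply: le_prob_after => S' SS'.
  rewrite negb_or => /andP[_]; apply: contraNT; rewrite -leNgt => h.
  exact: theta_add_expand hM jM h.
have rho1 : 1 <= rho by have := rho4; lra.
case: (subphase Esym L1 k'0 kk' hJ JL Lln J0 b0) => [h|[j /andP[j0 jJ] [M /andP[hM Mn] h]]|h].
- exists (J + J)%N => //.
  split; first by apply: (theta_add_ge (M := 0) hb S2 _).1; rewrite lexx /=.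
  apply: le_trans h; apply: le_prob_after => S' SS'.
  rewrite negb_or => /andP[_]; apply: contraNT; rewrite -leqNgt => h.
  by apply: theta_add_gain => //; rewrite -natrM ler_nat.
- apply: (expand j M) => //.
  (* Since [j <= 2 ^ j <= rho ^+ j], the number of rounds is bounded by [M / bd S]. *)
  + have hj : j%:R <= rho ^+ j.
      apply: (@le_trans _ _ (2 ^+ j)); last first.
        by rewrite lerXn2r ?nnegrE //; have := rho4; lra.
      by rewrite -natrX ler_nat ltnW // ltn_expl.
    have : j%:R * bd S <= M by apply: le_trans hM; rewrite ler_wpM2r // ltW.
    rewrite -ler_pdivlMr // => h1; have : 0 <= M / bd S by apply: le_trans h1.
    lra.
  + rewrite Mn andbT; apply: le_trans hM; rewrite ler_wpM2r ?(ltW b0R) //.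
    by rewrite ler_eXnr.
  + by apply: le_trans h _; apply: le_phase_fail; apply: leq_trans (ltnW jJ) (leq_addr _ _).
- have [tau [M [t0 tM hM hp]]] := high_large Esym L1 k'0 kk' Lln b0 h.
  apply: (expand tau M) => //; apply: le_trans hp _.
  by have := le_phase_fail T1; rewrite mul1r.
Qed.

End Additive.
End Regimes.

(** * Running the rounds backwards *)

Section Symmetry.
Variables (R : realType) (V : finType) (E : rel V) (k : nat).
Local Notation choices := (choices V k).
Local Notation run := (foldl (@push_pull V k)).

(** A push from [u] to [v] is a pull of [u] from [v] through the same sample, so a round is a
    symmetric relation. *)
Lemma push_pull_disjoint (A B : {set V}) (w : choices) :
  [disjoint push_pull A w & B] = [disjoint A & push_pull B w].
Proof.
have half (X Y : {set V}) : ~~ [disjoint push_pull X w & Y] -> ~~ [disjoint X & push_pull Y w].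
  move=> /pred0Pn[v /= /andP[/push_pullP[vX|[u uX [i wu]]|[i wv]] vY]]; apply/pred0Pn.
  - by exists v; rewrite /= vX; apply/push_pullP; constructor 1.
  - by exists u; rewrite /= uX; apply/push_pullP; constructor 3; exists i; rewrite wu.
  - by exists (w v i); rewrite /= wv; apply/push_pullP; constructor 2; exists v => //; exists i.
apply/idP/idP; apply: contraTT; last exact: half.
by rewrite disjoint_sym => h; rewrite disjoint_sym; exact: half.
Qed.

Lemma run_disjoint (A B : {set V}) (ws : seq choices) :
  [disjoint run A ws & B] = [disjoint A & run B (rev ws)].
Proof.
elim: ws A => //= w ws IH A; rewrite IH push_pull_disjoint.
by rewrite rev_cons -cats1 foldl_cat.
Qed.

Lemma run_meet (s v : V) (ws ws' : seq choices) :
  (#|V| < 2 * #|run [set s] ws|)%N -> (#|V| < 2 * #|run [set v] (rev ws')|)%N ->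
  v \in run [set s] (ws ++ ws').
Proof.
move=> hs hv; rewrite -[_ \in _]negbK -disjoints1 disjoint_sym foldl_cat run_disjoint.
rewrite -setI_eq0 -cards_eq0 -lt0n.
move: hs hv; set A := run _ _; set B := run _ _ => hs hv.
have mc : (#|A :|: B| <= #|V|)%N by exact: max_card.
by have := cardsUI A B; lia.
Qed.

(** Union bound over the source and all targets [v]: if the forward set of [s] and the backward set
    of [v] both exceed half of the nodes, they meet by [run_meet]. Reversed rounds have the same
    law. *)
Lemma prob_spread (N : nat) (p : R) (s : V) :
  (forall v, prob_after R E k N [set v] (fun S => ~~ (#|V| < 2 * #|S|)%N) <= p) ->
  prob_after R E k (N + N) [set s] (fun S => S != [set: V]) <= p + #|V|%:R * p.
Proof.
move=> hp; pose bad v (ws : seq choices) : R := (~~ (#|V| < 2 * #|run [set v] ws|)%N)%:R.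
pose Y := expects E N (fun u => expects E N (fun w => bad s u + \sum_v bad v (rev w))).
have hY : prob_after R E k (N + N) [set s] (fun S => S != [set: V]) <= Y.
  rewrite /prob_after expects_cat; apply: le_expects => u; apply: le_expects => w.
  have [//|h] := eqVneq (run [set s] (u ++ w)) [set: V].
    by move=> _; rewrite addr_ge0 ?ler0n // sumr_ge0 // => v _; exact: ler0n.
  have : ~~ ([set: V] \subset run [set s] (u ++ w)) by rewrite subTset.
  move=> /subsetPn[v _ hv]; rewrite (bigD1 v) //= addrA.
  have rest : 0 <= \sum_(i | i != v) bad i (rev w) by rewrite sumr_ge0 // => i _; exact: ler0n.
  apply: (@le_trans _ _ (bad s u + bad v (rev w))); last by rewrite lerDl.
  rewrite /bad -natrD ler1n addn_gt0 !lt0b -negb_and.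
  by apply: contra hv => /andP[h1 h2]; exact: run_meet.
apply: (le_trans hY).
have -> : Y = expects E N (bad s) + \sum_v expects E N (bad v).
  rewrite -[X in _ = _ + X](expects_cst E k N) -expectsD; apply: eq_expects => u.
  rewrite expectsD expects_cst expects_sum; congr (_ + _).
  by apply: eq_bigr => v _; exact: expects_rev.
apply: lerD; first exact: hp.
apply: (@le_trans _ _ (\sum_(v : V) p)); last by rewrite sumr_const mulr_natl.
by apply: ler_sum => v _; exact: hp.
Qed.

Lemma le_expects_size t (f g : seq choices -> R) :
  (forall ws, size ws = t -> f ws <= g ws) -> expects E t f <= expects E t g.
Proof.
elim: t f g => [|t IH] f g fg; first exact: fg.
by apply: le_expect => w; apply: IH => ws hws; apply: fg; rewrite /= hws.
Qed.

Lemma expects_take (f : seq choices -> R) (N t : nat) : (N <= t)%N ->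
  expects E N f = expects E t (fun ws => f (take N ws)).
Proof.
move=> Nt; rewrite -[in RHS](subnKC Nt) expects_cat.
have h u : size u = N -> f u = expects E (t - N) (fun v => f (take N (u ++ v))).
  move=> hu; rewrite -[LHS](expects_cst E k (t - N)); apply: eq_expects => v.
  by rewrite take_size_cat.
by apply/eqP; rewrite eq_le; apply/andP; split; apply: le_expects_size => u /h <-.
Qed.

Lemma Pr_rounds_required (N t : nat) (s : V) (x : R) : (N <= t)%N -> N%:R <= x ->
  1 - prob_after R E k N [set s] (fun S => S != [set: V])
    <= Pr E R (fun ws : t.-tuple choices => (rounds_required s ws)%:R <= x).
Proof.
move=> Nt Nx; rewrite (Pr_expects R E t (fun ws : seq choices => (rounds_required s ws)%:R <= x)).
rewrite lerBlDr -[leLHS](expects_cst E k t) /prob_after.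
rewrite (expects_take (fun ws => (run [set s] ws != [set: V])%:R) Nt) -expectsD.
apply: le_expects_size => ws hws.
have [h|_] := eqVneq (run [set s] (take N ws)) [set: V]; last by rewrite lerDr.
have hN : (rounds_required s ws <= N)%N.
  rewrite leqNgt; apply/negP => /(before_find 0%N).
  by rewrite nth_iota ?hws // add0n /informed h eqxx.
by rewrite addr0 ler1n lt0b; apply: le_trans Nx; rewrite ler_nat.
Qed.

End Symmetry.

(** * Boundaries in expanders *)

Section ExpanderBoundary.
Variables (R : realType) (V : finType) (E : rel V) (phi alpha : R).
Hypothesis Esym : symmetric E.
Hypothesis phi1 : 1 < phi.
Hypothesis halpha : (2 + 2 * phi)^-1 < alpha.
Hypothesis hexp : expander E phi alpha.
Hypothesis hround : small_rounding V phi alpha.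
Local Notation n := (#|V|%:R : R).
Local Notation gap := (alpha - (2 + 2 * phi)^-1).

Lemma card_V_gt1 : (1 < #|V|)%N.
Proof.
case: hexp => /andP[_ h] _ _; rewrite -(ltr_nat R); exact: lt_trans phi1 h.
Qed.

(** Expansion is applied to a subset [A] of [S] of the largest admissible size [f]. A set together
    with its boundary grows with the set, so the boundary of [S] has at least
    [(1 + phi) * f - n / 2] nodes. *)
Lemma large_boundary (S : {set V}) : alpha * n < #|S|%:R -> (2 * #|S| <= #|V|)%N ->
  Num.max 1 ((1 + phi) * gap * n / 2) <= #|boundary E S|%:R.
Proof.
move=> hS S2; have p1 := phi1; have hr := hround; rewrite /small_rounding in hr.
have n0 : 0 < n by rewrite ltr0n; apply: leq_trans card_V_gt1.
have p0 : 0 < 2 + 2 * phi by lra.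
have a0 : 0 < alpha by apply: lt_trans halpha; rewrite invr_gt0.
have an0 : 0 <= alpha * n by rewrite mulr_ge0 // ltW.
set f := Num.truncn (alpha * n) in hr.
have /andP[hf _] := truncn_itv an0; rewrite -/f in hf.
have fS : (f <= #|S|)%N by rewrite -(ler_nat R) ltW // (le_lt_trans hf).
(* By [small_rounding] truncation keeps half of the excess. *)
have hf2 : (alpha * n + n / (2 + 2 * phi)) / 2 <= f%:R by lra.
have np0 : 0 < n / (2 + 2 * phi) by rewrite divr_gt0.
pose A := subset_of_size f S.
have cA : #|A| = f by rewrite card_subset_of_size (minn_idPl fS).
have f0 : (0 < f)%N.
  by rewrite -(ltr_nat R); apply: lt_le_trans hf2; have := mulr_gt0 a0 n0; lra.
case: hexp => _ _ /(_ A); rewrite cA => /(_ f0 hf) hA.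
have : (#|A| + #|boundary E A| <= #|S| + #|boundary E S|)%N.
  have d : A :&: boundary E A = set0.
    by apply/setP => v; rewrite in_set0 in_setI in_setD; case: (v \in A).
  have := cardsUI A (boundary E A); rewrite d cards0 addn0 => <-.
  apply: leq_trans (leq_card_setU _ _).1; apply: subset_leq_card.
  apply/subsetP => v; rewrite in_setU [v \in S :|: _]in_setU => /orP[/(subsetP (subset_of_size_sub f S))->//|].
  rewrite !in_setD => /andP[_ vA]; rewrite (subsetP (nbhdS E (subset_of_size_sub f S)) _ vA) andbT.
  by case: (v \in S).
rewrite -(ler_nat R) !natrD cA => hcard.
have S2R : 2 * #|S|%:R <= n by rewrite -natrM ler_nat.
(* At the critical size [n / (2 + 2 * phi)] a set and its boundary just fill half of the nodes. *)
have half : (1 + phi) * (n / (2 + 2 * phi)) = n / 2.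
  by field; rewrite gt_eqF //; lra.
have hb : (1 + phi) * gap * n / 2 <= #|boundary E S|%:R.
  have -> : (1 + phi) * gap * n / 2 = ((1 + phi) * (alpha * n) - (1 + phi) * (n / (2 + 2 * phi))) / 2.
    by ring.
  have q0 : 0 <= 1 + phi by lra.
  by have := ler_wpM2l q0 hf2; rewrite half; lra.
rewrite ge_max hb andbT ler1n lt0n; apply: contraTneq hb => ->; rewrite -ltNge.
by rewrite divr_gt0 // !mulr_gt0 // ?subr_gt0 //; lra.
Qed.

(** Sets of at most half of the nodes have a boundary by expansion or by [large_boundary]; for
    larger ones an edge leaving the complement is read in the other direction. *)
Lemma boundary_gt0 (S : {set V}) : (0 < #|S|)%N -> S != [set: V] -> (0 < #|boundary E S|)%N.
Proof.
have low (A : {set V}) : (0 < #|A|)%N -> (2 * #|A| <= #|V|)%N -> (0 < #|boundary E A|)%N.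
  move=> A0 A2; have [h|h] := leP #|A|%:R (alpha * n).
    case: hexp => _ _ /(_ A A0 h) hA; rewrite -(ltr_nat R); apply: lt_le_trans hA.
    by rewrite mulr_gt0 ?ltr0n // (lt_trans ltr01).
  have := large_boundary h A2; rewrite ge_max => /andP[+ _].
  by rewrite ler1n.
move=> S0 ST; have [h|h] := leqP (2 * #|S|) #|V|; first exact: low.
have cS := cardsC S.
have C0 : (0 < #|~: S|)%N.
  rewrite card_gt0; apply: contra ST => /eqP h0.
  by rewrite -(setCK S) h0 setC0.
have C2 : (2 * #|~: S| <= #|V|)%N by lia.
have /card_gt0P[v] := low _ C0 C2; rewrite in_setD in_setC negbK => /andP[vS /nbhdP[u uS uv]].
apply/card_gt0P; exists u; rewrite in_setD; rewrite in_setC in uS; rewrite uS /=.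
by apply: in_nbhd vS _; rewrite nbC.
Qed.

End ExpanderBoundary.

(** * A crude bound for connected graphs *)

Section Crude.
Variables (R : realType) (V : finType) (E : rel V) (k : nat).
Hypothesis Esym : symmetric E.
Hypothesis k0 : (0 < k)%N.
Hypothesis conn : forall S : {set V}, (0 < #|S|)%N -> S != [set: V] -> (0 < #|boundary E S|)%N.
Local Notation n := (#|V|%:R : R).

(** A fixed boundary node pulls the rumor with probability of order at least [1 / n] per round, so a
    block of [t0] rounds informs a new node except with probability [expR (- (t0 / n))]. *)
Lemma prob_crude (t0 : nat) (s : V) : (0 < t0)%N ->
  prob_after R E k (t0 * #|V|) [set s] (fun S => S != [set: V])
    <= (t0 * #|V|).+1%:R * expR (- (t0%:R / n)).
Proof.
move=> t00; have s0 : (0 < #|[set s]|)%N by rewrite cards1.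
pose Theta (S : {set V}) : R := t0%:R * (n - #|S|%:R).
have Th : Theta [set s] <= (t0 * #|V|)%:R.
  by rewrite /Theta natrM ler_wpM2l // gerBl.
have t0R : 0 < t0%:R :> R by rewrite ltr0n.
apply: (prob_after_descent (Theta := Theta) (P := fun S : {set V} => (0 < #|S|)%N)
  (Tg := fun S : {set V} => S == [set: V]) _ _ _ _ s0 Th).
- exact: expR_ge0.
- by move=> A B AB A0; apply: leq_trans A0 _; exact: subset_leq_card.
- by move=> A B AB; rewrite -!subTset => h; exact: subset_trans h AB.
move=> S S0 ST; exists t0 => //.
have /card_gt0P[v] := conn S0 ST; rewrite in_setD => /andP[vS /nbhdP[u uS uv]].
have hgrow (S' : {set V}) : S \subset S' -> v \in S' -> #|S|%:R + 1 <= #|S'|%:R :> R.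
  move=> SS' vS'; rewrite natr1 ler_nat; apply: proper_card.
  by apply/properP; split => //; exists v.
split.
  have h : #|S|%:R + 1 <= n.
    by rewrite -cardsT; exact: (hgrow [set: V] (subsetT S) (in_setT v)).
  by rewrite /Theta ler_peMr // ?(ltW t0R) //; lra.
apply: (@le_trans _ _ (prob_after R E k t0 S (fun S' => [disjoint [set v] & S']))).
  apply: le_prob_after => S' SS'; rewrite negb_or disjoints1 => /andP[_].
  apply: contra => vS'; rewrite /Theta -lerBrDl -mulrBr ler_peMr ?(ltW t0R) //.
  by have := hgrow S' SS' vS'; lra.
apply: (@le_trans _ _ (expR (- n^-1) ^+ t0)); last by rewrite -expRM_natl mulrN.
apply: prob_after_stay; first exact: expR_ge0.
  by move=> A B AB; rewrite !disjoints1; apply: contra; exact: subsetP AB v.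
move=> S' SS' _; apply: le_trans (prob_no_pull _ E k S' [set v]) _.
rewrite big_set1 ler_expR lerN2.
have d0 : (0 < #|S' :&: nb E v|)%N.
  by apply/card_gt0P; exists u; rewrite in_setI (subsetP SS') // nbC.
have d1 : (0 < #|nb E v|)%N by apply: leq_trans d0 (subset_leq_card (subsetIr _ _)).
have dn : #|nb E v|%:R <= n by rewrite ler_nat max_card.
apply: (@le_trans _ _ (#|S' :&: nb E v|%:R / #|nb E v|%:R)); last by rewrite ler_peMl ?divr_ge0 ?ler1n.
apply: (@le_trans _ _ (#|nb E v|%:R^-1)).
  by rewrite lef_pV2 ?posrE ?ltr0n //; apply: leq_trans d1 (max_card _).
by rewrite ler_peMl ?invr_ge0 // ler1n.
Qed.

End Crude.

(** * Choice of the parameters *)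

Section Numerics.
Variable R : realType.
Implicit Types x y : R.

Lemma bernoulli x (m : nat) : 0 <= x -> 1 + m%:R * x <= (1 + x) ^+ m.
Proof.
move=> x0; elim: m => [|m IH]; first by rewrite mul0r expr0 addr0.
have p : 0 <= 1 + x by lra.
rewrite exprS; apply: le_trans (ler_wpM2l p IH); rewrite -natr1.
have := mulr_ge0 (ler0n R m) (mulr_ge0 x0 x0); lra.
Qed.

(** By Bernoulli, [(1 + x / 16) ^+ 17] is at least [1 + 17 * x / 16], hence at least [x]. *)
Lemma ln_le17 x : 1 < x -> ln x <= 17 * ln (1 + x / 16).
Proof.
move=> x1; have p : 0 < 1 + x / 16 by lra.
have -> : 17 * ln (1 + x / 16) = ln ((1 + x / 16) ^+ 17) by rewrite lnXn // mulr_natl.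
have h : 1 + 17 * (x / 16) <= (1 + x / 16) ^+ 17.
  by apply: (@bernoulli _ 17); rewrite divr_ge0 // (le_trans ler01) // ltW.
rewrite ler_ln ?posrE ?exprn_gt0 ?(lt_trans ltr01 x1) //; apply: le_trans h; lra.
Qed.

Lemma expR_le_ln x y : 0 < y -> expR x <= y -> x <= ln y.
Proof. by move=> y0 h; rewrite -ler_expR lnK. Qed.

Lemma ln17_ge x : 1 < x -> 17^-1 <= ln (1 + x / 16).
Proof.
move=> x1; apply: expR_le_ln; first lra.
have := expR_ge1Dx (- 17^-1 : R); have := expRxMexpNx_1 (17^-1 : R).
have := expR_ge0 (17^-1 : R); nra.
Qed.

Lemma expR1_le4 : expR 1 <= 4 :> R.
Proof.
have := @expR_half_le2 R; have := expR_ge0 (2^-1 : R).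
have -> : expR 1 = expR 2^-1 * expR 2^-1 :> R by rewrite -expRD; congr expR; lra.
nra.
Qed.

Lemma ln_ge_half (m : nat) : (1 < m)%N -> 2^-1 <= ln m%:R :> R.
Proof.
move=> m1; apply: expR_le_ln; first by rewrite ltr0n; lia.
by apply: le_trans (@expR_half_le2 R) _; rewrite ler_nat.
Qed.

Lemma powRN_expR x y : 0 < x -> x `^ (- y) = expR (- (y * ln x)).
Proof. by move=> x0; rewrite /powR gt_eqF // mulNr. Qed.

(** * Parameters in terms of the twelfth root [z] of [k] *)

Section Tuning.
Variables (lam z l : R) (k : nat).
Hypothesis lam4 : 4 <= lam.
Hypothesis zlam : 2 ^+ 22 * lam ^+ 2 <= z.
Hypothesis kz : k%:R = z ^+ 12.
Hypothesis l2 : 2^-1 <= l.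
Hypothesis lz : l <= z ^+ 4.
Let L := lam * l.
Let k' := Num.truncn (k%:R / (8 * L)).

Let lam0 : 0 < lam. Proof. by have := lam4; lra. Qed.

Let z4 : lam <= z /\ 4 <= z.
Proof.
have h1 : 1 <= lam by have := lam4; lra.
have h : lam <= z.
  apply: le_trans zlam; rewrite expr2 mulrA ler_peMl ?(ltW lam0) //.
  have : 1 <= 2 ^+ 22 :> R by rewrite exprn_ege1 //; lra.
  nra.
by split => //; have := lam4; lra.
Qed.

Lemma param_L : 1 <= L.
Proof. rewrite /L; have := lam4; have := l2; nra. Qed.

Let L0 : 0 < L := lt_le_trans ltr01 param_L.

Let z0 : 0 < z. Proof. by have [_ h] := z4; lra. Qed.

Let Lz5 : L <= lam * z ^+ 4.
Proof. by rewrite /L ler_wpM2l // ltW. Qed.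

(** Products of [L] with [J] or [l] are of order [lam * z ^+ 8]; the other four powers of [z] in [k]
    absorb the constants. *)
Lemma param_small (a : R) : 0 <= a <= 2 ^+ 22 * lam -> a * lam * z ^+ 8 <= k%:R.
Proof.
move=> /andP[a0 ha]; have [_ z4'] := z4.
have h : a * lam <= z.
  apply: le_trans zlam; rewrite expr2 mulrA ler_wpM2r //; exact: ltW.
have z1 : 1 <= z by lra.
rewrite kz (_ : 12 = 4 + 8)%N // exprD ler_wpM2r ?exprn_ge0 ?(ltW z0) //.
apply: le_trans h _; exact: ler_eXnr.
Qed.

Let big : 1000 <= 2 ^+ 22 * lam.
Proof.
have h1 : 1 <= lam by have := lam4; lra.
have h : 1000 <= 2 ^+ 22 :> R.
  apply: (@le_trans _ _ (2 ^+ 10)); last by rewrite ler_weXn2l //; lra.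
  by rewrite -natrX ler_nat.
have : 0 <= 2 ^+ 22 :> R by rewrite exprn_ge0.
nra.
Qed.

Let hk16 : 16 * L <= k%:R.
Proof.
have h : 16 * lam * z ^+ 8 <= k%:R by apply: param_small; have := big; lra.
apply: le_trans h; rewrite -mulrA ler_wpM2l //; apply: (le_trans Lz5).
have z48 : z ^+ 4 <= z ^+ 8 by have [_ z4'] := z4; rewrite ler_weXn2l //; lra.
by rewrite ler_wpM2l // ltW.
Qed.

Let L80 : 0 < 8 * L. Proof. by rewrite mulr_gt0. Qed.

Lemma param_k' : [/\ (0 < k')%N, 8 * L * k'%:R <= k%:R & k%:R <= 16 * L * k'%:R].
Proof.
have q0 : 0 <= k%:R / (8 * L) by rewrite divr_ge0 // ltW.
have /andP[h1 h2] := truncn_itv q0; rewrite -/k' in h1 h2; rewrite -[k'.+1%:R]natr1 in h2.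
have q2 : 2 <= k%:R / (8 * L).
  by rewrite ler_pdivlMr //; have := hk16; lra.
have k'1 : 1 <= k'%:R :> R.
  by rewrite /k' ler1n truncn_gt0; lra.
split; first by move: k'1; rewrite ler1n.
  by rewrite mulrC -ler_pdivlMr //.
have : k%:R / (8 * L) <= 2 * k'%:R by lra.
by rewrite ler_pdivrMr //; lra.
Qed.

(** [rho] is at least [k / (2 ^ 21 * L ^ 2)], and [L <= lam * z ^+ 4]; this is the origin of
    [2 ^ 22 * lam ^ 2 <= z]. *)
Lemma param_rho : 2 * z ^+ 3 <= rho k' L.
Proof.
have [_ _ h] := param_k'.
have -> : rho k' L = k'%:R / (8 * (16384 * L)) by rewrite /rho /kap; field; rewrite gt_eqF.
have den0 : 0 < 8 * (16384 * L) by apply: mulr_gt0 => //; apply: mulr_gt0.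
rewrite ler_pdivlMr //.
have L16 : 0 < 16 * L by rewrite mulr_gt0.
rewrite -(ler_pM2l L16).
apply: le_trans h; rewrite kz.
have LL : L * L <= lam ^+ 2 * z ^+ 8.
  have -> : lam ^+ 2 * z ^+ 8 = (lam * z ^+ 4) * (lam * z ^+ 4) by ring.
  exact: ler_pM (ltW L0) (ltW L0) Lz5 Lz5.
have z3 : 0 <= z ^+ 3 by rewrite exprn_ge0 // ltW.
have := ler_wpM2l z3 LL.
have z11 : 0 <= z ^+ 11 by rewrite exprn_ge0 // ltW.
have := ler_wpM2r z11 zlam.
have -> : 2 ^+ 22 * lam ^+ 2 * z ^+ 11 = 2 ^+ 22 * (z ^+ 3 * (lam ^+ 2 * z ^+ 8)) by ring.
have -> : z * z ^+ 11 = z ^+ 12 by ring.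
have -> : 16 * L * (2 * z ^+ 3 * (8 * (16384 * L))) = 2 ^+ 22 * (z ^+ 3 * (L * L)) by ring.
set c := 2 ^+ 22; have c0 : 0 <= c by rewrite exprn_ge0.
move=> h1 h2; exact: le_trans (ler_wpM2l c0 h2) h1.
Qed.

Lemma param_ln_z : 1 <= ln z.
Proof.
apply: expR_le_ln => //; apply: le_trans expR1_le4 _; by have [] := z4.
Qed.

Lemma param_ln_k : ln k%:R = 12 * ln z.
Proof. by rewrite kz lnXn // -[LHS]mulr_natl. Qed.

Let z3 : 64 <= z ^+ 3.
Proof.
have [_ h] := z4; have -> : 64 = 4 ^+ 3 :> R by ring.
by rewrite lerXn2r ?nnegrE //; exact: ltW.
Qed.

Lemma param_ln_rho : ln k%:R / 4 <= ln (rho k' L / 2).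
Proof.
have h := param_rho; rewrite param_ln_k.
have -> : 12 * ln z / 4 = ln (z ^+ 3) by rewrite lnXn // -[RHS]mulr_natl; lra.
have z30 : 0 < z ^+ 3 by rewrite exprn_gt0.
rewrite ler_ln ?posrE //; lra.
Qed.

Lemma param_ln_kap : ln k%:R / 4 <= ln (kap R k').
Proof.
apply: le_trans param_ln_rho _; have h := param_rho; have := z3 => h3.
have r0 : 0 < rho k' L by lra.
have hk : rho k' L <= kap R k'.
  have -> : kap R k' = rho k' L * (16384 * L) by rewrite /rho; field; rewrite gt_eqF.
  by rewrite ler_peMr ?(ltW r0) //; have := param_L; lra.
rewrite ler_ln ?posrE //; lra.
Qed.

Lemma param_J (m : nat) : (1 < m)%N -> l = ln m%:R ->
  exists2 J : nat, 4 * m%:R ^+ 2 < kap R k' ^+ J.-1 & [/\ (0 < J)%N,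
    J%:R <= 16 * (l / ln k%:R) + 2 & 4 * J%:R * L <= k%:R].
Proof.
move=> m1 lm; have hk := param_ln_kap; have hz := param_ln_z; have ek := param_ln_k.
have m0 : 0 < m%:R :> R by rewrite ltr0n ltnW.
have l0 : 0 < l by have := l2; lra.
have lk0 : 0 < ln (kap R k') by lra.
have lK0 : 0 < ln k%:R :> R by lra.
have kap0 : 0 < kap R k'.
  rewrite ltNge; apply/negP => h; by move: lk0; rewrite ln0 // ltxx.
have hm : ln (4 * m%:R ^+ 2) <= 4 * l.
  have -> : 4 * l = ln (m%:R ^+ 4) by rewrite lnXn // -lm -[RHS]mulr_natl.
  have m20 : 0 < m%:R ^+ 2 :> R by rewrite exprn_gt0.
  rewrite ler_ln ?posrE ?exprn_gt0 // ?mulr_gt0 //.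
  have -> : m%:R ^+ 4 = m%:R ^+ 2 * m%:R ^+ 2 :> R by ring.
  rewrite ler_wpM2r ?(ltW m20) // -natrX ler_nat (_ : 4 = 2 ^ 2)%N //.
  by rewrite leq_exp2r.
set x := ln (4 * m%:R ^+ 2) / ln (kap R k').
have x0 : 0 <= x.
  rewrite divr_ge0 ?(ltW lk0) // ln_ge0 //.
  have : 1 <= m%:R ^+ 2 :> R by rewrite exprn_ege1 // ler1n ltnW.
  lra.
have /andP[t1 t2] := truncn_itv x0.
have hx : x <= 16 * (l / ln k%:R).
  rewrite /x ler_pdivrMr //; apply: le_trans hm _.
  have : 16 * (l / ln k%:R) * (ln k%:R / 4) <= 16 * (l / ln k%:R) * ln (kap R k').
    by rewrite ler_wpM2l // mulr_ge0 // divr_ge0 // ltW.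
  by have -> : 16 * (l / ln k%:R) * (ln k%:R / 4) = 4 * l by field; rewrite gt_eqF.
have hJ : (Num.truncn x).+2%:R <= 16 * (l / ln k%:R) + 2.
  by rewrite -!natr1; lra.
(* [J - 1] is the truncation of [x] plus one, hence exceeds [x]. *)
exists (Num.truncn x).+2; last split => //.
  rewrite /= -[4 * _]lnK ?posrE ?mulr_gt0 ?exprn_gt0 // -[kap R k' in ltRHS]lnK //.
  rewrite -expRM_natl ltr_expR.
  by rewrite -ltr_pdivrMr.
have hl : l / ln k%:R <= l.
  by rewrite ler_pdivrMr // ler_peMr ?(ltW l0) //; lra.
have [_ zz4] := z4.
have z41 : 1 <= z ^+ 4 by rewrite exprn_ege1 //; lra.
have hJ2 : (Num.truncn x).+2%:R <= 18 * z ^+ 4 by have := lz; lra.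
have h : 72 * lam * z ^+ 8 <= k%:R by apply: param_small; have := big; lra.
apply: le_trans h.
have -> : 72 * lam * z ^+ 8 = 4 * (18 * z ^+ 4) * (lam * z ^+ 4) by ring.
apply: ler_pM => //; first by rewrite mulr_ge0.
  exact: ltW.
by rewrite ler_wpM2l.
Qed.

Lemma param_harmonic : 2 * L * (2 + l) <= k%:R.
Proof.
have [_ zz4] := z4.
have z41 : 1 <= z ^+ 4 by rewrite exprn_ege1 //; lra.
have h : 6 * lam * z ^+ 8 <= k%:R by apply: param_small; have := big; lra.
apply: le_trans h.
have -> : 6 * lam * z ^+ 8 = 2 * (lam * z ^+ 4) * (3 * z ^+ 4) by ring.
have l0 : 0 <= l by have := l2; lra.
have a1 : 0 <= 2 * L by apply: mulr_ge0 => //; exact: ltW.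
have a2 : 0 <= 2 + l by rewrite addr_ge0.
have a3 : 2 * L <= 2 * (lam * z ^+ 4) by apply: ler_wpM2l => //; exact: Lz5.
have a4 : 2 + l <= 3 * z ^+ 4 by have := lz; lra.
exact: ler_pM a1 a2 a3 a4.
Qed.

End Tuning.
End Numerics.

(** * The case of large [k] *)

Section LargeCase.
Variables (R : realType) (V : finType) (E : rel V) (phi alpha : R) (k : nat) (c z : R).
Hypothesis Esym : symmetric E.
Hypothesis phi1 : 1 < phi.
Hypothesis halpha : (2 + 2 * phi)^-1 < alpha.
Hypothesis hexp : expander E phi alpha.
Hypothesis hround : small_rounding V phi alpha.
Hypothesis c0 : 0 < c.
Local Notation n := (#|V|%:R : R).
Local Notation gap := (alpha - (2 + 2 * phi)^-1).
Local Notation lam := (4 * (c + 23)).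
Hypothesis zlam : 2 ^+ 22 * lam ^+ 2 <= z.
Hypothesis kz : k%:R = z ^+ 12.
Hypothesis lz : ln n <= z ^+ 4.
Local Notation mx := (Num.max 1 (logb k%:R n)).

Lemma mul_bound (T q r x y : R) : 0 <= T <= 36 * y -> 0 <= q <= 4 * y -> 0 <= r <= 17 * x ->
  1 <= x -> 0 <= y -> (T + q) * (r + 1) + q <= 724 * (x * y).
Proof.
move=> /andP[T0 hT] /andP[q0 hq] /andP[r0 hr] x1 y0.
have a : T + q <= 40 * y by lra.
have b : r + 1 <= 18 * x by lra.
have h : (T + q) * (r + 1) <= 40 * y * (18 * x) by apply: ler_pM => //; lra.
have := ler_wpM2r y0 x1; lra.
Qed.

Lemma add_bound (T y : R) : 0 <= T <= 36 * y -> 1 <= y -> 16 * T + 102 <= 678 * y.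
Proof. by move=> /andP[_ hT] y1; lra. Qed.

Lemma rounds_total (b1 b2 x y : R) (m1 m2 : nat) : m1%:R <= b1 -> m2%:R <= b2 ->
  b1 <= 724 * x -> b2 <= 1356 * y -> 1 <= x -> 0 <= y ->
  (m1.+1 + m2.+1 + (m1.+1 + m2.+1))%:R <= 3000 * (x + y).
Proof. by move=> *; rewrite !natrD -[m1.+1%:R]natr1 -[m2.+1%:R]natr1; lra. Qed.

(** The choice of [lam] makes [expR (- (L / 4))] equal to the power [- c - 23] of [n]. Union bounds
    and constants cost [2 ^ 18 * n ^ 5] at most, and [2 <= n]. *)
Lemma fail_bound (N J : nat) : (1 < #|V|)%N -> N%:R <= 1406 * (n * n) ->
  (J + J)%:R <= 36 * n ->
  N%:R * phase_fail V (lam * ln n) J + n * (N%:R * phase_fail V (lam * ln n) J) <= n `^ (- c).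
Proof.
move=> n1 hN hT; have n0 : 0 < n by rewrite ltr0n ltnW.
have n2 : 2 <= n by rewrite (ler_nat R 2).
rewrite powRN_expR // /phase_fail /fail_pr.
have -> : expR (- (lam * ln n / 4)) = expR (- (c * ln n)) * (n ^+ 23)^-1.
  have -> : n ^+ 23 = expR (23 * ln n) by rewrite expRM_natl lnK.
  by rewrite -expRN -expRD; congr expR; lra.
set e := expR _; set m := n; rewrite -/m in n0 n2 hN hT *.
have e0 : 0 <= e by exact: expR_ge0.
have p0 : 0 < m ^+ 23 by rewrite exprn_gt0.
set x := N%:R in hN *; set T := (J + J)%:R in hT *.
have -> : x * (T * (2 * m * (e * (m ^+ 23)^-1))) + m * (x * (T * (2 * m * (e * (m ^+ 23)^-1))))
    = e * ((1 + m) * (x * T) * (2 * m) / m ^+ 23).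
  by field; rewrite gt_eqF.
rewrite ler_piMr // ler_pdivrMr // mul1r.
have xT : x * T <= 1406 * (m * m) * (36 * m) by apply: ler_pM.
have m3 : 0 <= 1406 * (m * m) * (36 * m).
  by apply: mulr_ge0; apply: mulr_ge0 => //; rewrite ?mulr_ge0 // ltW.
have h1 : (1 + m) * (x * T) <= 2 * m * (1406 * (m * m) * (36 * m)).
  by apply: ler_pM => //; [lra|rewrite mulr_ge0|lra].
have h2 : (1 + m) * (x * T) * (2 * m) <= 2 * m * (1406 * (m * m) * (36 * m)) * (2 * m).
  by rewrite ler_wpM2r // mulr_ge0 // ltW.
apply: (le_trans h2).
have -> : 2 * m * (1406 * (m * m) * (36 * m)) * (2 * m) = (4 * (1406 * 36)) * m ^+ 5 by ring.
have -> : m ^+ 23 = m ^+ 18 * m ^+ 5 by rewrite -exprD.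
rewrite ler_wpM2r ?exprn_ge0 ?(ltW n0) //.
apply: (@le_trans _ _ (2 ^+ 18)); first lra.
by rewrite lerXn2r ?nnegrE // ltW.
Qed.

Lemma spread_time (N1 N2 : nat) (L : R) (J k' : nat) (s : V) :
  1 <= L -> (0 < k')%N -> 8 * L * k'%:R <= k%:R ->
  4 * n ^+ 2 < kap R k' ^+ J.-1 -> 4 * J%:R * L <= k%:R ->
  2 * L * (2 + ln n) <= k%:R -> (0 < J)%N -> 4 <= rho k' L ->
  ((J + J)%:R + ln n / ln (rho k' L / 2)) * (ln n / ln (1 + phi / 16) + 1)
     + ln n / ln (rho k' L / 2) <= N1%:R ->
  (16 * (J + J)%:R + 102) * n / Num.max 1 ((1 + phi) * gap * n / 2) <= N2%:R ->
  prob_after R E k (N1 + N2) [set s] (fun S => ~~ (#|V| < 2 * #|S|)%N)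
    <= (N1.+1 + N2.+1)%:R * phase_fail V L J.
Proof.
move=> L1 k'0 kk' hJ JL Lln J0 rho4 h1 h2.
have pf0 := phase_fail_ge0 V L J.
have hphi (S : {set V}) : (0 < #|S|)%N -> #|S|%:R <= alpha * n ->
    phi * #|S|%:R <= #|boundary E S|%:R.
  by case: hexp => _ _; apply.
have hbeta (S : {set V}) := large_boundary phi1 halpha hexp hround (S := S).
have b0 : 0 <= N2.+1%:R * phase_fail V L J by rewrite mulr_ge0.
have s0 : (0 < #|[set s]|)%N by rewrite cards1.
rewrite natrD mulrDl.
apply: le_trans (prob_after_add (E := E) (k := k) N1 (t2 := N2) (S := [set s])
  (G := fun S => alpha * n < #|S|%:R) b0 _) _.
  move=> S' _ hS'.
  apply: (reach_add Esym L1 k'0 kk' hJ JL Lln J0 rho4 _ hbeta hS').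
    by rewrite le_max lexx.
  by apply: le_trans h2; apply: theta_add_le; rewrite ?le_max ?lexx.
rewrite lerD2r.
apply: (reach_mul Esym L1 k'0 kk' hJ JL Lln J0 rho4 phi1 hphi s0).
by apply: le_trans h1; apply: theta_mul_le.
Qed.

Lemma large_case (s : V) :
  exists2 N : nat, N%:R <= 3000 * rounds_bound #|V| k phi alpha &
    prob_after R E k N [set s] (fun S => S != [set: V]) <= n `^ (- c).
Proof.
have n1 := card_V_gt1 phi1 hexp.
have lam4 : 4 <= lam by have := c0; lra.
set l := ln n; have l2 : 2^-1 <= l by exact: ln_ge_half.
set L := lam * l; set k' := Num.truncn (k%:R / (8 * L)).
have L1 : 1 <= L := param_L lam4 l2.
have [k'0 kk' _] := param_k' lam4 zlam kz l2 lz.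
have hrho := param_rho lam4 zlam kz l2 lz.
have hlnrho := param_ln_rho lam4 zlam kz l2 lz.
have hlnz := param_ln_z lam4 zlam.
have hlnk := param_ln_k lam4 zlam kz.
have Lln := param_harmonic lam4 zlam kz l2 lz.
have [J hJ [J0 hJl JL]] := param_J lam4 zlam kz l2 lz n1 (erefl _).
rewrite -/L -/k' in k'0 kk' hrho hlnrho Lln hJ JL.
have z4 : 4 <= z.
  apply: le_trans zlam; have h1 : 1 <= 2 ^+ 22 :> R by rewrite exprn_ege1 //; lra.
  have h2 : 4 <= lam ^+ 2.
    by rewrite expr2; apply: (le_trans lam4); rewrite ler_peMl //; have := lam4; lra.
  by apply: (le_trans h2); rewrite ler_peMl // (le_trans _ h2).
have z3 : 4 <= z ^+ 3.
  by apply: (le_trans z4); rewrite ler_eXnr //; lra.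
have rho4 : 4 <= rho k' L by lra.
set K := ln k%:R in hlnrho hlnk hJl.
have K0 : 0 < K by rewrite hlnk; lra.
have l0 : 0 < l by lra.
have n0 : 0 < n by rewrite ltr0n ltnW.
have n1R : 1 <= n by rewrite ler1n ltnW.
have lnn : l <= n.
  by apply: ltW; apply: ln_sublinear.
have mx1 : 1 <= mx by rewrite le_max lexx.
have mxl : l / K <= mx by rewrite le_max /logb lexx orbT.
have mxn : mx <= n.
  rewrite ge_max n1R /= /logb -/l -/K; apply: le_trans lnn.
  by rewrite ler_pdivrMr // ler_peMr ?(ltW l0) //; lra.
set T := (J + J)%:R : R.
(* [T] is at most [32 * (l / K) + 4], and both [l / K] and 1 are at most [mx]. *)
have hT : 0 <= T <= 36 * mx.
  by rewrite ler0n /= /T natrD; lra.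
set q := l / ln (rho k' L / 2).
have lr0 : 0 < ln (rho k' L / 2) by lra.
have hq : 0 <= q <= 4 * mx.
  rewrite divr_ge0 ?(ltW l0) ?(ltW lr0) //= ler_pdivrMr //.
  apply: (@le_trans _ _ (4 * (l / K) * (K / 4))).
    by have -> : 4 * (l / K) * (K / 4) = l by field; rewrite gt_eqF.
  have a : 4 * (l / K) <= 4 * mx by apply: ler_wpM2l.
  have b : 0 <= 4 * (l / K) by rewrite mulr_ge0 // divr_ge0 // ltW.
  by apply: (ler_pM b _ a hlnrho); rewrite divr_ge0 // ltW.
set r := l / ln (1 + phi / 16).
have hr17 := ln17_ge phi1; have hphi17 := ln_le17 phi1.
have r10 : 0 < ln (1 + phi / 16) by apply: lt_le_trans hr17; rewrite invr_gt0.
have lnphi0 : 0 < ln phi by rewrite ln_gt0.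
set lb := logb phi n.
have lb1 : 1 <= lb.
  rewrite /lb /logb ler_pdivlMr // mul1r ler_ln ?posrE ?(lt_trans ltr01 phi1) //.
  by case: hexp => /andP[_ /ltW].
have r0 : 0 <= r by rewrite divr_ge0 ?(ltW l0) ?(ltW r10).
have hr1 : 0 <= r <= 17 * lb.
  rewrite r0 /= ler_pdivrMr //.
  apply: (@le_trans _ _ (lb * (17 * ln (1 + phi / 16)))); last by lra.
  apply: (@le_trans _ _ (lb * ln phi)); first by rewrite /lb /logb divfK // gt_eqF.
  by rewrite ler_wpM2l //; lra.
(* A second, cruder estimate in terms of [n] alone, for the number of rounds in [fail_bound]. *)
have hr2 : 0 <= r <= 17 * n.
  rewrite r0 /= ler_pdivrMr //; apply: le_trans lnn _.
  apply: (@le_trans _ _ (17 * n * 17^-1)); first by lra.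
  by rewrite ler_wpM2l // mulr_ge0 // ltW.
set B1 := (T + q) * (r + 1) + q.
have mx0 : 0 <= mx := le_trans ler01 mx1.
have B1lb : B1 <= 724 * (lb * mx) := mul_bound hT hq hr1 lb1 mx0.
have hTn : 0 <= T <= 36 * n.
  by case/andP: hT => -> /=; move/le_trans; apply; rewrite ler_wpM2l.
have hqn : 0 <= q <= 4 * n.
  by case/andP: hq => -> /=; move/le_trans; apply; rewrite ler_wpM2l.
have B1n : B1 <= 724 * (n * n) := mul_bound hTn hqn hr2 n1R (ltW n0).
set beta := Num.max 1 ((1 + phi) * gap * n / 2).
have beta1 : 1 <= beta by rewrite le_max lexx.
have beta0 : 0 < beta := lt_le_trans ltr01 beta1.
have gap0 : 0 < gap by rewrite subr_gt0.
have phi0 : 0 < phi := lt_trans ltr01 phi1.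
have nbeta1 : n / beta <= n by rewrite ler_pdivrMr // ler_peMr // ltW.
(* The second summand of [rounds_bound] arises here, from the lower bound [beta] on the boundary. *)
have nbeta2 : n / beta <= 2 * (phi^-1 * gap^-1).
  rewrite ler_pdivrMr //; apply: (@le_trans _ _ (2 * (phi^-1 * gap^-1) * ((1 + phi) * gap * n / 2))).
    have -> : 2 * (phi^-1 * gap^-1) * ((1 + phi) * gap * n / 2) = n * ((1 + phi) / phi).
      by move: gap0; set g := gap => g0; field; rewrite !gt_eqF.
    by rewrite ler_peMr ?(ltW n0) // ler_pdivlMr // mul1r lerDr.
  rewrite ler_wpM2l ?mulr_ge0 ?invr_ge0 ?(ltW phi0) ?(ltW gap0) //.
  by rewrite le_max lexx orbT.
have nbeta0 : 0 <= n / beta by rewrite divr_ge0 ?(ltW n0) ?(ltW beta0).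
set B2 := (16 * T + 102) * n / beta.
have B2e : B2 <= 678 * mx * (n / beta).
  by rewrite /B2 -mulrA ler_wpM2r // add_bound.
have B2b : B2 <= 1356 * (phi^-1 * gap^-1 * mx).
  apply: (le_trans B2e); have e : 1356 * (phi^-1 * gap^-1 * mx) = 678 * mx * (2 * (phi^-1 * gap^-1)).
    by move: (phi^-1 * gap^-1) mx => a b; ring.
  by rewrite e; apply: ler_wpM2l => //; rewrite mulr_ge0.
have B2n : B2 <= 678 * (n * n).
  apply: le_trans B2e _; rewrite -mulrA ler_wpM2l //; exact: ler_pM.
have B10 : 0 <= B1.
  by case/andP: hT => T0 _; case/andP: hq => q0 _; rewrite addr_ge0 // mulr_ge0 ?addr_ge0.
have B20 : 0 <= B2.
  by case/andP: hT => T0 _; rewrite /B2 -mulrA mulr_ge0 // addr_ge0 // mulr_ge0.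
have /andP[t1 t2] := truncn_itv B10; have /andP[u1 u2] := truncn_itv B20.
set N1 := Num.truncn B1 in t1 t2; set N2 := Num.truncn B2 in u1 u2.
exists (N1.+1 + N2.+1 + (N1.+1 + N2.+1))%N.
  rewrite /rounds_bound -/lb.
  have lbmx : 1 <= lb * mx by rewrite mulr_ege1.
  have gmx : 0 <= phi^-1 * gap^-1 * mx by rewrite !mulr_ge0 ?invr_ge0 ?(ltW phi0) ?(ltW gap0).
  have htot := rounds_total t1 u1 B1lb B2b lbmx gmx; by rewrite [X in 3000 * X]mulrDl.
have hp v := spread_time v L1 k'0 kk' hJ JL Lln J0 rho4 (ltW t2) (ltW u2).
apply: le_trans (prob_spread s hp) _.
have cast : (N1.+2 + N2.+2)%:R = N1%:R + N2%:R + 4 :> R by rewrite natrD -!natr1; ring.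
apply: fail_bound => //; last by case/andP: hTn.
rewrite cast; have n4 : 4 <= n * n.
  by rewrite -natrM (ler_nat R 4) (@leq_mul 2 2).
lra.
Qed.

End LargeCase.

(** * Bounded [n] and the choice of the constants *)

Lemma rounds_bound_ge1 (R : realType) (V : finType) (E : rel V) (phi alpha : R) (k : nat) :
  1 < phi -> (2 + 2 * phi)^-1 < alpha -> expander E phi alpha ->
  1 <= rounds_bound #|V| k phi alpha.
Proof.
move=> phi1 halpha [/andP[_ /ltW phin] _ _].
have phi0 : 0 < phi := lt_trans ltr01 phi1.
have n0 : 0 < #|V|%:R := lt_le_trans phi0 phin.
have lnphi0 : 0 < ln phi by rewrite ln_gt0.
have lb1 : 1 <= logb phi #|V|%:R.
  by rewrite /logb ler_pdivlMr // mul1r ler_ln ?posrE.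
have g0 : 0 <= phi^-1 * (alpha - (2 + 2 * phi)^-1)^-1.
  by rewrite mulr_ge0 // invr_ge0 ?(ltW phi0) // subr_ge0 ltW.
apply: mulr_ege1; last by rewrite le_max lexx.
by apply: (le_trans lb1); rewrite lerDl.
Qed.

(** From [expR (- x) <= 2 / x ^ 2] the left side is at most [4 * n ^ 3 / t0]. *)
Lemma crude_bound (R : realType) (c : R) (m0 n t0 : nat) : 0 < c -> (1 < n <= m0)%N ->
  4 * m0%:R ^+ 3 * expR (c * ln m0%:R) <= t0%:R :> R ->
  (t0 * n).+1%:R * expR (- (t0%:R / n%:R)) <= n%:R `^ (- c) :> R.
Proof.
move=> c0 /andP[n1 nm] ht.
have n0 : 0 < n%:R :> R by rewrite ltr0n ltnW.
have m00 : 0 < m0%:R :> R by rewrite ltr0n (leq_trans _ nm) // ltnW.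
have hn : n%:R <= m0%:R :> R by rewrite ler_nat.
have ht2 : 4 * n%:R ^+ 3 * expR (c * ln n%:R) <= t0%:R :> R.
  apply: le_trans ht; apply: ler_pM; rewrite ?expR_ge0 ?mulr_ge0 ?exprn_ge0 ?ler0n //.
    by rewrite ler_wpM2l // lerXn2r // nnegrE.
  by rewrite ler_expR ler_wpM2l ?(ltW c0) // ler_ln ?posrE.
have t0R : 0 < t0%:R :> R.
  by apply: lt_le_trans ht2; rewrite !mulr_gt0 ?exprn_gt0 ?expR_gt0.
have t01 : 1 <= t0%:R :> R by rewrite ler1n; rewrite ltr0n in t0R.
have n1R : 1 <= n%:R :> R by rewrite ler1n ltnW.
have h2 : (t0 * n).+1%:R <= 2 * (t0%:R * n%:R) :> R.
  rewrite -natr1 natrM; have : 1 <= t0%:R * n%:R :> R by rewrite mulr_ege1.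
  lra.
have h3 : expR (- (t0%:R / n%:R)) <= 2 * n%:R ^+ 2 / t0%:R ^+ 2 :> R.
  rewrite expRN; apply: (@le_trans _ _ ((t0%:R / n%:R) ^+ 2 / 2)^-1).
    rewrite lef_pV2 ?posrE ?expR_gt0 ?divr_gt0 ?exprn_gt0 ?divr_gt0 //.
    have := @expR_ge1Dxn R (t0%:R / n%:R) 1; rewrite divr_ge0 ?ler0n // => /(_ isT).
    have -> : 2`!%:R = 2 :> R by [].
    lra.
  by rewrite le_eqVlt; apply/orP; left; apply/eqP; field; rewrite !gt_eqF.
rewrite powRN_expR // expRN; apply: (@le_trans _ _ (2 * (t0%:R * n%:R) * (2 * n%:R ^+ 2 / t0%:R ^+ 2))).
  by apply: ler_pM => //; exact: expR_ge0.
have -> : 2 * (t0%:R * n%:R) * (2 * n%:R ^+ 2 / t0%:R ^+ 2) = 4 * n%:R ^+ 3 / t0%:R :> R.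
  by field; rewrite gt_eqF.
by rewrite ler_pdivrMr // [leRHS]mulrC ler_pdivlMr ?expR_gt0.
Qed.

Theorem theorem1p2 (R : realType) (c : R) (hc : 0 < c) :
  exists2 C : R, 0 < C &
    forall (V : finType) (E : rel V), symmetric E -> irreflexive E ->
    forall (phi alpha : R) (k : nat),
      1 < phi -> (2 + 2 * phi)^-1 < alpha ->
      expander E phi alpha -> small_rounding V phi alpha ->
      (ln (#|V|%:R : R)) ^+ 3 < k%:R ->
    forall (s : V) (t : nat), C * rounds_bound #|V| k phi alpha <= t%:R ->
      1 - #|V|%:R `^ (- c) <=
        Pr E R (fun ws : t.-tuple (choices V k) =>
          (rounds_required s ws)%:R <= C * rounds_bound #|V| k phi alpha).
Proof.
(* [large_case] needs [Z <= z]. Otherwise [ln n <= Z ^+ 4], so [n] is at most a constant [m0] and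
   the crude bound applies. *)
pose Z : R := 2 ^+ 22 * (4 * (c + 23)) ^+ 2.
have Z0 : 0 <= Z by rewrite mulr_ge0 ?exprn_ge0 ?mulr_ge0 ?addr_ge0 ?(ltW hc).
have [m0 hm0] : exists m0 : nat, expR (Z ^+ 4) <= m0%:R.
  by exists (Num.truncn (expR (Z ^+ 4))).+1; have /andP[_ /ltW] := truncn_itv (expR_ge0 (Z ^+ 4)).
have [t0 t00 ht0] : exists2 t0 : nat, (0 < t0)%N &
    4 * m0%:R ^+ 3 * expR (c * ln m0%:R) <= t0%:R :> R.
  have h0 : 0 <= 4 * m0%:R ^+ 3 * expR (c * ln m0%:R) :> R.
    by rewrite !mulr_ge0 ?exprn_ge0 ?expR_ge0.
  by exists (Num.truncn (4 * m0%:R ^+ 3 * expR (c * ln m0%:R) : R)).+1; have /andP[_ /ltW] := truncn_itv h0.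
(* The two summands serve the two cases; the second one suffices alone because [rounds_bound] is at
   least 1. *)
exists (3000 + (t0 * m0)%:R); first by rewrite ltr_pwDl.
move=> V E Esym _ phi alpha k phi1 halpha hexp hround hk s t ht.
have b1 := rounds_bound_ge1 k phi1 halpha hexp.
set b := rounds_bound _ _ _ _ in ht b1 *.
have n1 := card_V_gt1 phi1 hexp.
have l0 : 0 < ln (#|V|%:R : R) by apply: lt_le_trans (ln_ge_half R n1); rewrite invr_gt0.
have k0R : 0 < k%:R :> R by apply: le_lt_trans hk; rewrite exprn_ge0 // ltW.
suff [N hN hp] : exists2 N : nat, N%:R <= (3000 + (t0 * m0)%:R) * b &
    prob_after R E k N [set s] (fun S => S != [set: V]) <= #|V|%:R `^ (- c).
  have Nt : (N <= t)%N by rewrite -(ler_nat R); exact: le_trans hN ht.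
  by apply: (le_trans _ (Pr_rounds_required E k s Nt hN)); rewrite lerD2l lerN2.
(* With the twelfth root, the hypothesis on [k] becomes [ln n <= z ^+ 4]. *)
pose z : R := expR (ln k%:R / 12).
have kz : k%:R = z ^+ 12.
  rewrite /z -expRM_natl; have -> : 12 * (ln k%:R / 12) = ln k%:R :> R by field.
  by rewrite lnK.
have z0 : 0 <= z by exact: expR_ge0.
have lz : ln (#|V|%:R : R) <= z ^+ 4.
  rewrite leNgt; apply/negP => h; move: hk; rewrite kz ltNge => /negP[].
  have -> : z ^+ 12 = (z ^+ 4) ^+ 3 by rewrite -exprM.
  by rewrite lerXn2r ?nnegrE ?exprn_ge0 ?(ltW l0) // ltW.
have [zZ|zZ] := leP Z z.
  have [M hM hpM] := large_case Esym phi1 halpha hexp hround hc zZ kz lz s.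
  exists M => //; apply: (le_trans hM); rewrite ler_wpM2r ?(le_trans ler01 b1) //.
  by rewrite lerDl.
have nm : (#|V| <= m0)%N.
  have h : #|V|%:R <= expR (Z ^+ 4).
    rewrite -[#|V|%:R]lnK ?posrE ?ltr0n ?(ltnW n1) // ler_expR; apply: le_trans lz _.
    by rewrite lerXn2r ?nnegrE // ltW.
  by rewrite -(ler_nat R) (le_trans h).
exists (t0 * #|V|)%N.
  apply: (@le_trans _ _ (t0 * m0)%:R); first by rewrite ler_nat leq_mul2l nm orbT.
  apply: (@le_trans _ _ (3000 + (t0 * m0)%:R)); first by rewrite lerDr.
  by rewrite ler_peMr // addr_ge0.
apply: le_trans (prob_crude R Esym _ (boundary_gt0 Esym phi1 halpha hexp hround) s _) _ => //.
  by move: k0R; rewrite ltr0n.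
by apply: crude_bound ht0 => //; rewrite n1.
Qed.
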